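(* Let $X$ be a Banach space, $c\in\mathbb N$, $1\le p\le\infty$, and let $g$ be a weight on $\mathbb Z^c$ satisfying conditions (a)–(e) below. Then the subalgebra $\widetilde{\mathfrak s_{1,g}}\bigl(\mathbb Z^c,\mathfrak S_1(X)\bigr)$ is full (inverse-closed) in the algebra $\mathcal B\bigl(l_p(\mathbb Z^c,X)\bigr)$. In particular, if $T\in\mathfrak s_{1,g}\bigl(\mathbb Z^c,\mathfrak S_1(X)\bigr)$, $\lambda\in\mathbb C$, and $\lambda\mathbf 1+T$ is invertible in $\mathcal B\bigl(l_p(\mathbb Z^c,X)\bigr)$, then (for $X$ infinite-dimensional) $\lambda\ne0$ and $(\lambda\mathbf 1+T)^{-1}=\frac1\lambda\mathbf 1+T_1$ with $T_1\in\mathfrak s_{1,g}\bigl(\mathbb Z^c,\mathfrak S_1(X)\bigr)$.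
   Context: A weight on $\mathbb Z^c$ is a function $g:\mathbb Z^c\to(0,\infty)$; here it is assumed to satisfy: (a) $g(0)=1$; (b) $g(m+n)\le g(m)g(n)$; (c) $g(-n)=g(n)$; (d) $g(n)\ge1$; (e) for every $t\in\mathbb Z^c$, $\lim_{n\to\infty,\,n\in\mathbb Z}\sqrt[n]{g(nt)}=1$ (equivalently $\ln g(nt)/n\to0$). $l_{1,g}(\mathbb Z^c,\mathbb C)$ is the space of families $\beta=\{\beta_m\}_{m\in\mathbb Z^c}$ with $\sum_m g(m)|\beta_m|<\infty$. $l_p(\mathbb Z^c,X)$ is the usual Banach space of $X$-valued families with $\ell^p$ norm ($\sup$ norm for $p=\infty$). A bounded operator $A$ on $X$ is nuclear if $Ax=\sum_{i\ge1}a_i(x)y_i$ with $a_i\in X^*$, $y_i\in X$, $\sum_i\|a_i\|\|y_i\|<\infty$; $\mathfrak S_1(X)$ denotes the nuclear operators, with nuclear norm $\|A\|_{\mathfrak S_1}=\inf\sum_i\|a_i\|\|y_i\|$ over all such representations. $\mathfrak s_{1,g}\bigl(\mathbb Z^c,\mathfrak S_1(X)\bigr)$ (''locally nuclear operators'') is the set of operators $T\in\mathcal B(l_p(\mathbb Z^c,X))$ of the form $(Tx)_k=\sum_{m\in\mathbb Z^c}b_{km}x_{k-m}$, $k\in\mathbb Z^c$, where $b_{km}\in\mathfrak S_1(X)$ and $\|b_{km}\|_{\mathfrak S_1}\le\beta_m$ for all $k,m$, for some nonnegative $\beta\in l_{1,g}(\mathbb Z^c,\mathbb C)$. $\widetilde{\mathfrak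 s_{1,g}}\bigl(\mathbb Z^c,\mathfrak S_1(X)\bigr)$ denotes $\{\lambda\mathbf 1+T:\lambda\in\mathbb C,\ T\in\mathfrak s_{1,g}(\mathbb Z^c,\mathfrak S_1(X))\}$ if $X$ is infinite-dimensional, and $\mathfrak s_{1,g}(\mathbb Z^c,\mathfrak S_1(X))$ itself if $X$ is finite-dimensional. A unital subalgebra $\mathcal R$ of a unital algebra $\mathcal B$ is full (inverse-closed) if every $B\in\mathcal R$ invertible in $\mathcal B$ has its inverse in $\mathcal R$. *)

(* Defs.v *)
From HB Require Import structures.
From mathcomp Require Import all_boot all_order all_algebra.
From mathcomp Require Import all_classical all_reals all_analysis.
From mathcomp Require Import complex finmap.
Set Implicit Arguments. Unset Strict Implicit. Unset Printing Implicit Defensive.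
Import Order.TTheory GRing.Theory Num.Theory numFieldNormedType.Exports.
Local Open Scope classical_set_scope.
Local Open Scope complex_scope.
Local Open Scope ring_scope.

Section Defs.
Variable R : realType.
Notation C := R[i].
Variable X : completeNormedModType C.

Definition Zc (c : nat) := 'rV[int]_c.

(* real-valued norm on X (the library norm takes values in C, real and >= 0) *)
Definition nrm (x : X) : R := complex.Re `|x|.
Definition cabs (a : C) : R := complex.Re `|a|.

Definition is_weight (c : nat) (g : Zc c -> R) : Prop :=
  [/\ g 0 = 1,
      (forall m n, g (m + n) <= g m * g n),
      (forall n, g (- n) = g n),
      (forall n, 1 <= g n) &
      (forall t : Zc c, (fun n : nat => g (t *+ n) `^ (n%:R^-1)) @ \oo --> (1 : R))].

Definition l1g (c : nat) (g : Zc c -> R) (beta : Zc c -> R) : Prop :=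
  (\esum_(m in [set: Zc c]) (g m * `|beta m|)%:E < +oo)%E.

(* l_p norm in \bar R (p in [1, +oo]); +oo when the family is not in l_p *)
Definition lp_norm (c : nat) (p : \bar R) (x : Zc c -> X) : \bar R :=
  match p with
  | EFin q => poweR (\esum_(k in [set: Zc c]) ((nrm (x k)) `^ q)%:E)%E q^-1
  | _ => ereal_sup [set (nrm (x k))%:E | k in [set: Zc c]]
  end.

Definition lp_mem (c : nat) (p : \bar R) (x : Zc c -> X) : Prop :=
  (lp_norm p x < +oo)%E.

(* bounded linear operators on l_p(Z^c, X); operators are maps on all
   families and only their behaviour on l_p matters *)
Definition bounded_op (c : nat) (p : \bar R) (A : (Zc c -> X) -> (Zc c -> X))
  : Prop :=
  [/\ (forall x, lp_mem p x -> lp_mem p (A x)),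
      (forall (a : C) x y, lp_mem p x -> lp_mem p y ->
          A (fun k => a *: x k + y k) = (fun k => a *: A x k + A y k)) &
      (exists M : R, forall x, lp_mem p x -> (lp_norm p (A x) <= M%:E * lp_norm p x)%E)].

Definition inverse_in_B (c : nat) (p : \bar R)
  (A B : (Zc c -> X) -> (Zc c -> X)) : Prop :=
  [/\ bounded_op p A, bounded_op p B &
      forall x, lp_mem p x -> A (B x) = x /\ B (A x) = x].

Definition lin_functional (f : X -> C) : Prop :=
  forall (a : C) x y, f (a *: x + y) = a * f x + f y.

(* operator norm of a functional (+oo if unbounded) *)
Definition dual_norm (f : X -> C) : \bar R :=
  ereal_inf [set M%:E | M in [set M : R | 0 <= M /\ forall x, cabs (f x) <= M * nrm x]].

Definition nuclear_rep (A : X -> X) (a : nat -> X -> C) (y : nat -> X) : Prop :=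
  [/\ (forall i, lin_functional (a i)),
      (\sum_(i <oo) (dual_norm (a i) * (nrm (y i))%:E) < +oo)%E &
      (forall x, (fun n : nat => \sum_(i < n) a i x *: y i) @ \oo --> A x)].

Definition nuclear (A : X -> X) : Prop :=
  exists a y, nuclear_rep A a y.

Definition nuclear_norm (A : X -> X) : \bar R :=
  ereal_inf [set (\sum_(i <oo) (dual_norm (ay.1 i) * (nrm (ay.2 i))%:E))%E
            | ay in [set ay : (nat -> X -> C) * (nat -> X) | nuclear_rep A ay.1 ay.2]].

Definition unord_sum_to (I : choiceType) (F : I -> X) (l : X) : Prop :=
  forall e : R, 0 < e -> exists A : {fset I}, forall B : {fset I},
    (A `<=` B)%fset -> nrm (l - \sum_(i <- B) F i) < e.

Definition locally_nuclear (c : nat) (p : \bar R) (g : Zc c -> R)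
  (T : (Zc c -> X) -> (Zc c -> X)) : Prop :=
  bounded_op p T /\
  exists (b : Zc c -> Zc c -> X -> X) (beta : Zc c -> R),
    [/\ (forall m, 0 <= beta m), l1g g beta,
        (forall k m, nuclear (b k m) /\ (nuclear_norm (b k m) <= (beta m)%:E)%E) &
        (forall x, lp_mem p x -> forall k : Zc c,
            unord_sum_to (fun m : Zc c => b k m (x (k - m))) (T x k))].

Definition finite_dim : Prop :=
  exists (n : nat) (v : 'I_n -> X), forall x, exists a : 'I_n -> C,
    x = \sum_(i < n) a i *: v i.

Definition tilde_s1g (c : nat) (p : \bar R) (g : Zc c -> R)
  (S : (Zc c -> X) -> (Zc c -> X)) : Prop :=
  (finite_dim -> locally_nuclear p g S) /\
  (~ finite_dim -> exists (lam : C) (T : (Zc c -> X) -> (Zc c -> X)),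
      locally_nuclear p g T /\
      forall x, lp_mem p x -> S x = (fun k => lam *: x k + T x k)).

End Defs.

(* Main.v *)
Require Import Defs.
From HB Require Import structures.
From mathcomp Require Import all_boot all_order all_algebra.
From mathcomp Require Import all_classical all_reals all_analysis.
From mathcomp Require Import complex finmap.
From mathcomp Require Import ring lra zify.
Import Order.TTheory GRing.Theory Num.Theory numFieldNormedType.Exports.
Local Open Scope classical_set_scope.
Local Open Scope complex_scope.
Local Open Scope ring_scope.
Set Implicit Arguments. Unset Strict Implicit. Unset Printing Implicit Defensive.

(* Let A = lam + T be invertible on l_p with inverse B of norm at most M, and let
   phi_k (i) = q ^ |i - k|_1 with 0 < q < 1.  Since
     |phi_k (i - m) - phi_k (i)| <= (1 - q ^ |m|_1) (phi_k (i - m) + phi_k (i))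
   and phi_k (i) = phi_(k - m) (i - m), Minkowski's inequality bounds the
   commutator of T with multiplication by phi_k, so that for y = A x the local
   norms alpha_k = ||phi_k x||_p satisfy
     alpha_k <= M ||phi_k y||_p
        + M sum_m beta_m (1 - q ^ |m|_1) (alpha_k + alpha_(k - m)).
   For q close to 1 the kernel of this inequality has small l_(1,g) norm, and a
   Neumann series gives alpha <= gamma * |y|.  The family gamma lies in l_(1,g)
   because condition (e) makes sum_m g(m) q ^ |m|_1 finite.  In particular
   |(B y)_k| <= sum_m gamma_m |y_(k - m)| for every y in l_p, which shows, also
   for p = +oo, that B is given by a matrix whose entries decay like gamma.

   If lam <> 0, then B - 1/lam = T (- B / lam) has nuclear entries, dominated by
   beta * gamma.  If lam = 0, then T B = 1 exhibits the identity of X as a nuclear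
   operator; this makes every entry of B nuclear, and it forces X to be
   finite-dimensional, since the identity is then within distance 1/2 of a
   finite-rank operator. *)

(** * Sums and convolutions of extended reals *)

Section EsumTheory.
Context {R : realType} {T : choiceType}.
Local Open Scope ereal_scope.

Lemma esum_term (a : T -> \bar R) i :
  (forall j, 0 <= a j) -> a i <= \esum_(j in [set: T]) a j.
Proof.
move=> a0; apply: esum_ge; exists [set i]; first by split.
by rewrite fsbig_set1.
Qed.

Lemma esumZl (c : \bar R) (a : T -> \bar R) : 0 <= c -> (forall i, 0 <= a i) ->
  \esum_(i in [set: T]) (c * a i) = c * \esum_(i in [set: T]) a i.
Proof.
move=> c0 a0; case: c c0 => [r| |] //; rewrite ?lee_fin => c0.
  rewrite /esum -ereal_supZl//; last first.
    by apply/set0P; exists 0, set0; [exact: fsets_set0|rewrite fsbig_set0].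
  congr ereal_sup; rewrite image_comp; apply: eq_imagel => A [finA _] /=.
  by rewrite ge0_mule_fsumr.
(* The factor is [+oo]: both sides are 0 if every term vanishes, since [+oo * 0 = 0], and [+oo]
   otherwise. *)
have [aE|] := pselect (forall i, a i = 0).
  rewrite !esum1 ?mule0// => i _; rewrite aE ?mule0//.
move=> /existsNP[i /eqP ai0].
have ai : 0 < a i by rewrite lt0e ai0 a0.
rewrite [RHS]gt0_mulye; last exact: lt_le_trans (esum_term i a0).
apply/eqP; rewrite -leye_eq.
have := @esum_term (fun i => +oo * a i) i; rewrite gt0_mulye//; apply.
by move=> j; rewrite mule_ge0.
Qed.

Lemma exchange_esum (T' : choiceType) (a : T -> T' -> \bar R) :
  (forall i j, 0 <= a i j) ->
  \esum_(i in [set: T]) \esum_(j in [set: T']) a i j =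
  \esum_(j in [set: T']) \esum_(i in [set: T]) a i j.
Proof.
move=> a0; rewrite (esum_esum (J := fun=> setT))// (esum_esum (J := fun=> setT))//.
rewrite (reindex_esum ([set: T'] `*`` fun=> [set: T]) _ (fun x => (x.2, x.1)))//.
split=> //=; first by move=> [i1 i2] [j1 j2] /= _ _ [] -> ->.
by move=> [i1 i2] _ /=; exists (i2, i1).
Qed.

Lemma esum_fset_le (a : T -> \bar R) (B : {fset T}) : (forall j, 0 <= a j) ->
  \sum_(i <- B) a i <= \esum_(j in [set: T]) a j.
Proof.
move=> a0; apply: esum_ge; exists [set` B]; first by split.
by rewrite fsbig_finite//= set_fsetK.
Qed.

Lemma esum_le_fset (a : T -> \bar R) (x : \bar R) :
  (forall B : {fset T}, \sum_(i <- B) a i <= x) ->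
  \esum_(j in [set: T]) a j <= x.
Proof.
move=> h; apply: ge_ereal_sup => _ [A [finA _] <-].
by rewrite fsbig_finite.
Qed.

(** Take [A] whose partial sum exceeds the total minus [e]. A larger [B] carries at least as much,
    so less than [e] is left outside it. *)
Lemma esum_tail (a : T -> \bar R) (e : R) : (forall i, 0 <= a i) ->
  \esum_(i in [set: T]) a i < +oo -> (0 < e)%R ->
  exists A : {fset T}, forall B : {fset T}, (A `<=` B)%fset ->
    \esum_(i in [set: T]) (if i \in B then 0 else a i) < e%:E.
Proof.
move=> a0 aoo e0.
have s0 : 0 <= \esum_(i in [set: T]) a i by apply: esum_ge0 => *.
have sfin : \esum_(i in [set: T]) a i \is a fin_num by rewrite ge0_fin_numE.
have : \esum_(i in [set: T]) a i - e%:E < \esum_(i in [set: T]) a i.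
  by rewrite lteBlDr// lteDl.
move=> /ereal_sup_gt[_ [A [finA _] <-]] hA.
exists (fset_set A) => B AB.
have split_a : \esum_(i in [set: T]) a i =
    \esum_(i in [set: T]) (if i \in B then a i else 0) +
    \esum_(i in [set: T]) (if i \in B then 0 else a i).
  rewrite -esumD; do ?by move=> i _; case: ifP.
  by apply: eq_esum => i _; case: ifP; rewrite ?addr0 ?add0r ?adde0 ?add0e.
have tail_le : \esum_(i in [set: T]) (if i \in B then 0 else a i) \is a fin_num.
  rewrite ge0_fin_numE; last by apply: esum_ge0 => i _; case: ifP.
  by apply: le_lt_trans aoo; apply: le_esum => i _; case: ifP.
have headge : \sum_(i \in A) a i <=
    \esum_(i in [set: T]) (if i \in B then a i else 0).
  rewrite fsbig_finite//=.
  apply: le_trans (esum_fset_le (fset_set A) _); last by move=> i; case: ifP.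
  rewrite big_seq [leRHS]big_seq; apply: lee_sum => i iA.
  by rewrite (fsubsetP AB _ iA).
have := lt_le_trans hA headge.
rewrite split_a lteBlDr// lteD2lE//.
rewrite ge0_fin_numE; last by apply: esum_ge0 => i _; case: ifP.
by apply: le_lt_trans aoo; apply: le_esum => i _; case: ifP.
Qed.

End EsumTheory.

Section Convolution.
Context {R : realType} {G : zmodType}.
Local Open Scope ereal_scope.
Implicit Types f g h : G -> \bar R.

Lemma esum_subr f k :
  \esum_(m in [set: G]) f (k - m)%R = \esum_(m in [set: G]) f m.
Proof.
rewrite [RHS](reindex_esum [set: G] _ (fun m => k - m)%R)//.
split=> //=; first by move=> x y _ _ /addrI /oppr_inj.
by move=> y _ /=; exists (k - y)%R => //; rewrite subKr.
Qed.

Lemma esum_subl f k :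
  \esum_(m in [set: G]) f (m - k)%R = \esum_(m in [set: G]) f m.
Proof.
rewrite [RHS](reindex_esum [set: G] _ (fun m => m - k)%R)//.
split=> //=; first by move=> x y _ _ /addIr.
by move=> y _ /=; exists (y + k)%R => //; rewrite addrK.
Qed.

Definition convol f h (k : G) : \bar R := \esum_(m in [set: G]) (f m * h (k - m)%R).

Lemma convol_ge0 f h k : (forall m, 0 <= f m) -> (forall m, 0 <= h m) ->
  0 <= convol f h k.
Proof. by move=> f0 h0; apply: esum_ge0 => m _; rewrite mule_ge0. Qed.

Lemma le_convol f h h' k : (forall m, 0 <= f m) -> (forall m, h m <= h' m) ->
  convol f h k <= convol f h' k.
Proof. by move=> f0 hh; apply: le_esum => m _; rewrite lee_wpmul2l. Qed.

Lemma convolDr f h h' k : (forall m, 0 <= f m) -> (forall m, 0 <= h m) ->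
  (forall m, 0 <= h' m) ->
  convol f (fun m => h m + h' m) k = convol f h k + convol f h' k.
Proof.
move=> f0 h0 h'0; rewrite /convol -esumD; do ?by move=> m _; rewrite mule_ge0.
by apply: eq_esum => m _; rewrite ge0_muleDr.
Qed.

Lemma convol_cst f c k : (forall m, 0 <= f m) -> 0 <= c ->
  convol f (fun=> c) k = c * \esum_(m in [set: G]) f m.
Proof.
by move=> f0 c0; rewrite /convol -esumZl//; apply: eq_esum => m _; rewrite muleC.
Qed.

Lemma convol_sumr f (H : nat -> G -> \bar R) n k : (forall m, 0 <= f m) ->
  (forall i m, 0 <= H i m) ->
  convol f (fun m => \sum_(i < n) H i m) k = \sum_(i < n) convol f (H i) k.
Proof.
move=> f0 H0; rewrite /convol -esum_sum; last by move=> *; rewrite mule_ge0.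
by apply: eq_esum => m _; rewrite ge0_sume_distrr.
Qed.

Lemma convolA f g h k : (forall m, 0 <= f m) -> (forall m, 0 <= g m) ->
  (forall m, 0 <= h m) -> convol f (convol g h) k = convol (convol f g) h k.
Proof.
move=> f0 g0 h0; rewrite /convol.
transitivity (\esum_(m in [set: G]) \esum_(d in [set: G])
   (f m * g (d - m)%R * h (k - d)%R)).
  apply: eq_esum => m _.
  rewrite -(esum_subl _ m) -esumZl//; last by move=> d; rewrite mule_ge0.
  apply: eq_esum => d _; rewrite muleA.
  by rewrite (_ : k - m - (d - m) = k - d)%R// opprB addrA subrK.
rewrite exchange_esum; last by move=> *; rewrite !mule_ge0.
apply: eq_esum => d _; rewrite muleC -esumZl//; last by move=> *; rewrite mule_ge0.
by apply: eq_esum => m _; rewrite muleC.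
Qed.

(** Since w(k) <= w(m) w(k - m), the weights can be distributed over both factors; Tonelli and
    translation invariance then split the double sum. *)
Lemma weighted_esum_convol (w : G -> R) f h : (forall m, 0 <= w m)%R ->
  (forall m n, w (m + n) <= w m * w n)%R ->
  (forall m, 0 <= f m) -> (forall m, 0 <= h m) ->
  \esum_(k in [set: G]) ((w k)%:E * convol f h k) <=
  (\esum_(k in [set: G]) ((w k)%:E * f k)) * \esum_(k in [set: G]) ((w k)%:E * h k).
Proof.
move=> w0 wM f0 h0.
apply: (@le_trans _ _ (\esum_(k in [set: G]) \esum_(m in [set: G])
  ((w m)%:E * f m * ((w (k - m)%R)%:E * h (k - m)%R)))).
  apply: le_esum => k _; rewrite -esumZl ?lee_fin//; last by move=> *; rewrite mule_ge0.
  apply: le_esum => m _; rewrite muleACA -EFinM lee_wpmul2r ?mule_ge0// lee_fin.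
  by rewrite -{1}(subrKC m k) wM.
rewrite exchange_esum; last by move=> *; rewrite !mule_ge0// lee_fin.
rewrite [leRHS]muleC -esumZl; last 2 first.
- by apply: esum_ge0 => *; rewrite mule_ge0// lee_fin.
- by move=> *; rewrite mule_ge0// lee_fin.
apply: le_esum => m _; rewrite esumZl; last 2 first.
- by rewrite mule_ge0// lee_fin.
- by move=> *; rewrite mule_ge0// lee_fin.
by rewrite (esum_subl (fun k => (w k)%:E * h k)) muleC.
Qed.

End Convolution.

(** * Neumann series for convolution inequalities *)

Section Neumann.
Context {R : realType}.
Local Open Scope ereal_scope.

Lemma esum_geometric (r : R) : (0 <= r < 1)%R ->
  \esum_(n in [set: nat]) (r ^+ n)%:E <= ((1 - r)^-1)%:E.
Proof.
move=> /andP[r0 r1]; rewrite -nneseries_esumT; last first.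
  by move=> n; rewrite lee_fin exprn_ge0.
have r1' : (0 < 1 - r)%R by lra.
apply: lime_le; first by apply: is_cvg_nneseries => n _ _; rewrite lee_fin exprn_ge0.
apply: nearW => n; rewrite sumEFin lee_fin big_mkord -[leRHS]mul1r ler_pdivlMr//.
rewrite mulrC -(opprB r 1) mulNr -subrX1 opprB.
by have := exprn_ge0 n r0; lra.
Qed.

Lemma exists_halving (M e : R) : (0 < e)%R -> exists N, (2^-1 ^+ N * M < e)%R.
Proof.
move=> e0; exists (Num.bound (`|M| / e)); set N := Num.bound _.
have hN : (`|M| / e < N%:R)%R by rewrite archi_boundP// divr_ge0// ltW.
have h2 : (N%:R <= 2 ^+ N :> R)%R.
  by rewrite -natrX ler_nat ltnW// ltn_expl.
rewrite exprVn mulrC ltr_pdivrMr ?exprn_gt0//.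
rewrite (le_lt_trans (ler_norm _))// mulrC -ltr_pdivrMr//.
exact: lt_le_trans hN h2.
Qed.

Context {G : zmodType} (w : G -> R) (V F : G -> \bar R).
Hypotheses (w1 : forall m, (1 <= w m)%R)
  (wM : forall m n, (w (m + n) <= w m * w n)%R)
  (V0 : forall m, 0 <= V m) (F0 : forall m, 0 <= F m)
  (wV : \esum_(m in [set: G]) ((w m)%:E * V m) <= (2^-1)%:E)
  (wF : \esum_(m in [set: G]) ((w m)%:E * F m) < +oo).

(** The n-th term of the Neumann series: [F] convolved n times with [V]. *)
Let W n := iter n (convol V) F.

Let w0 m : (0 <= w m)%R. Proof. exact: le_trans (w1 m). Qed.

Let W0 n m : 0 <= W n m.
Proof. by elim: n m => [//|n IH] m; apply: convol_ge0. Qed.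

Let S := \esum_(m in [set: G]) ((w m)%:E * F m).

Let wW n : \esum_(m in [set: G]) ((w m)%:E * W n m) <= (2^-1 ^+ n)%:E * S.
Proof.
elim: n => [|n IH]; first by rewrite expr0 mul1e.
apply: le_trans (weighted_esum_convol w0 wM V0 (W0 n)) _.
rewrite exprS EFinM -muleA; apply: lee_pmul => //.
  by apply: esum_ge0 => m _; rewrite mule_ge0// lee_fin.
by apply: esum_ge0 => m _; rewrite mule_ge0// lee_fin.
Qed.

Let V_half : \esum_(m in [set: G]) V m <= (2^-1)%:E.
Proof.
apply: le_trans wV; apply: le_esum => m _.
by rewrite -{1}(mul1e (V m)) lee_wpmul2r// lee_fin.
Qed.

(** Inserting the bound for [N] into [convol V alpha] adds one Neumann term and halves the
    remainder, because [V] has total mass at most 1/2. *)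
Let iterate (M : R) (alpha h : G -> \bar R) : (forall m, 0 <= h m) -> (0 <= M)%R ->
  (forall k, alpha k <= M%:E) ->
  (forall k, alpha k <= convol F h k + convol V alpha k) ->
  forall N k, alpha k <= \sum_(n < N) convol (W n) h k + (2^-1 ^+ N * M)%:E.
Proof.
move=> h0 M0 aM ale; elim=> [|N IH] k; first by rewrite big_ord0 add0e expr0 mul1r.
apply: le_trans (ale k) _.
rewrite big_ord_recl -addeA leeD2l//.
apply: (le_trans (le_convol _ V0 IH)).
rewrite convolDr//; last 2 first.
- by move=> m; apply: sume_ge0 => n _; apply: convol_ge0.
- by move=> _; rewrite lee_fin mulr_ge0// exprn_ge0// invr_ge0.
rewrite (@convol_sumr _ _ V (fun n => convol (W n) h))//; last by move=> *; apply: convol_ge0.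
apply: leeD.
  by rewrite le_eqVlt; apply/orP; left; apply/eqP; apply: eq_bigr => n _; rewrite convolA.
have c0 : (0 <= 2^-1 ^+ N * M)%R by rewrite mulr_ge0// exprn_ge0// invr_ge0.
rewrite convol_cst//.
by rewrite exprSr mulrAC [leRHS]EFinM lee_wpmul2l.
Qed.

(** The kernel is the sum of all [W n]; its weighted mass is at most that of [F] times the sum of
    the powers of 1/2. It is fixed before [M], [alpha] and [h]; the a priori bound [M] makes the
    remainder vanish in the limit. *)
Lemma conv_inequality : exists gamma : G -> R,
  [/\ forall m, (0 <= gamma m)%R,
      \esum_(m in [set: G]) (w m * gamma m)%:E < +oo &
      forall (M : R) (alpha h : G -> \bar R), (forall m, 0 <= h m) -> (0 <= M)%R ->
      (forall k, alpha k <= M%:E) ->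
      (forall k, alpha k <= convol F h k + convol V alpha k) ->
      forall k, alpha k <= convol (fun m => (gamma m)%:E) h k].
Proof.
pose gam m := \esum_(n in [set: nat]) W n m.
have gam0 m : 0 <= gam m by apply: esum_ge0 => n _.
have wgam : \esum_(m in [set: G]) ((w m)%:E * gam m) < +oo.
  under eq_esum do rewrite -esumZl ?lee_fin//.
  rewrite exchange_esum; last by move=> *; rewrite mule_ge0// lee_fin.
  apply: (@le_lt_trans _ _ (\esum_(n in [set: nat]) (S * (2^-1 ^+ n)%:E))).
    by apply: le_esum => n _; rewrite muleC.
  have S0 : 0 <= S by apply: esum_ge0 => m _; rewrite mule_ge0// lee_fin.
  rewrite esumZl//.
  have half : (0 <= (2^-1 : R) < 1)%R by apply/andP; split; lra.
  rewrite lte_mul_pinfty// ?ge0_fin_numE//.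
  by apply: le_lt_trans (esum_geometric half) _; rewrite ltry.
have gamfin m : gam m \is a fin_num.
  rewrite ge0_fin_numE//; apply: le_lt_trans wgam.
  apply: le_trans (esum_term m _); last by move=> *; rewrite mule_ge0// lee_fin.
  by rewrite -{1}(mul1e (gam m)) lee_wpmul2r// lee_fin.
exists (fun m => fine (gam m)); split => [m||M alpha h h0 M0 aM ale k].
- by rewrite fine_ge0.
- by under eq_esum do rewrite EFinM fineK//.
- apply/lee_addgt0Pr => e e0; have [N hN] := exists_halving M e0.
  apply: le_trans (iterate h0 M0 aM ale N k) _; apply: leeD; last by rewrite lee_fin ltW.
  rewrite /convol -esum_sum; last by move=> *; rewrite mule_ge0.
  apply: le_esum => m _; rewrite fineK// -ge0_sume_distrl; last by move=> *.
  rewrite lee_wpmul2r// /gam -nneseries_esumT// -(big_mkord xpredT (fun n => W n m)).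
  by apply: nneseries_lim_ge.
Qed.

End Neumann.

(** * The scalar l_p norm *)

Section FiniteHoelder.
Context {R : realType}.
Implicit Types q a b : R.

(** Young's inequality with exponents q / (q - 1) and q. At q = 1 the first exponent degenerates,
    and both sides equal [b]. *)
Lemma young_powR q a b : 1 <= q -> 0 <= a -> 0 <= b ->
  a `^ (q - 1) * b <= (1 - q^-1) * a `^ q + q^-1 * b `^ q.
Proof.
rewrite le_eqVlt => /predU1P[<-|q1] a0 b0.
  by rewrite subrr powRr0 invr1 subrr mul0r add0r !mul1r powRr1.
have q10 : 0 < q - 1 by lra.
have q0 : 0 < q by lra.
have r0 : 0 < q / (q - 1) by rewrite divr_gt0.
have rq : (q / (q - 1))^-1 + q^-1 = 1 by field; rewrite !gt_eqF.
apply: le_trans (conjugate_powR (powR_ge0 a (q - 1)) b0 r0 q0 rq) _.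
rewrite -powRrM (_ : (q - 1) * (q / (q - 1)) = q); last by field; rewrite gt_eqF.
rewrite le_eqVlt; apply/orP; left; apply/eqP.
by field; rewrite !gt_eqF.
Qed.

(** Scale [u] by 1 / U and [v] by 1 / L, then sum Young's inequality. Writing the power q - 1
    instead of a conjugate exponent includes q = 1. *)
Lemma hoelder_seq (T : Type) q (s : seq T) (u v : T -> R) (U L : R) :
  1 <= q -> 0 < U -> 0 < L -> (forall i, 0 <= u i) -> (forall i, 0 <= v i) ->
  \sum_(i <- s) u i `^ q <= U `^ q -> \sum_(i <- s) v i `^ q <= L `^ q ->
  \sum_(i <- s) u i `^ (q - 1) * v i <= U `^ (q - 1) * L.
Proof.
move=> q1 U0 L0 u0 v0 uU vL.
have q0 : 0 < q by lra.
have i01 : 0 <= q^-1 <= 1 by rewrite invr_ge0 invf_le1// q1 ltW.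
have Y i : u i `^ (q - 1) * v i <= U `^ (q - 1) * L *
    ((1 - q^-1) * ((U `^ q)^-1 * u i `^ q) + q^-1 * ((L `^ q)^-1 * v i `^ q)).
  have := @young_powR q (U^-1 * u i) (L^-1 * v i) q1.
  rewrite !mulr_ge0 ?invr_ge0 ?(ltW U0) ?(ltW L0)// => /(_ isT isT).
  rewrite !powRM// ?invr_ge0 ?(ltW U0) ?(ltW L0)//.
  have E (x y : R) : 0 < x -> x^-1 `^ y = (x `^ y)^-1.
    by move=> x0; rewrite -(powR_inv1 (ltW x0)) -powRrM mulN1r powRN.
  rewrite !E// => h.
  have UL0 : 0 < U `^ (q - 1) * L by rewrite mulr_gt0 ?powR_gt0.
  rewrite -ler_pdivrMl//; apply: le_trans h.
  rewrite le_eqVlt; apply/orP; left; apply/eqP.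
  by field; rewrite !gt_eqF ?powR_gt0.
apply: (@le_trans _ _ (\sum_(i <- s) U `^ (q - 1) * L *
    ((1 - q^-1) * ((U `^ q)^-1 * u i `^ q) + q^-1 * ((L `^ q)^-1 * v i `^ q)))).
  by apply: ler_sum => i _.
rewrite -mulr_sumr ler_piMr ?mulr_ge0 ?powR_ge0 ?(ltW L0)//.
rewrite big_split/= -!mulr_sumr.
have h1 : (U `^ q)^-1 * \sum_(i <- s) u i `^ q <= 1.
  by rewrite ler_pdivrMl ?powR_gt0// mulr1.
have h2 : (L `^ q)^-1 * \sum_(i <- s) v i `^ q <= 1.
  by rewrite ler_pdivrMl ?powR_gt0// mulr1.
case/andP: i01 => i0 i1.
have := ler_wpM2l i0 h2.
have := @ler_wpM2l _ (1 - q^-1) _ _ _ h1; rewrite subr_ge0 => /(_ i1).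
lra.
Qed.

End FiniteHoelder.

Section ScalarLp.
Context {R : realType} {G : zmodType}.
Local Open Scope ereal_scope.
Implicit Types (p : \bar R) (u v : G -> R).

(** Scalar counterpart of [lp_norm], with the same clauses, so that [lp_norm p x] is convertible to
    [lpR p] of the family of norms of [x]. *)
Definition lpR p u : \bar R :=
  match p with
  | EFin q => poweR (\esum_(k in [set: G]) (u k `^ q)%:E) q^-1
  | _ => ereal_sup [set (u k)%:E | k in [set: G]]
  end.

Lemma le_ereal_sup_range u k :
  (u k)%:E <= ereal_sup [set (u k)%:E | k in [set: G]].
Proof. by apply: ereal_sup_ubound; exists k. Qed.

Lemma lpR_ge0 p u : 1 <= p -> (forall k, 0 <= u k)%R -> 0 <= lpR p u.
Proof.
case: p => [q| |] //= _ u0; first exact: poweR_ge0.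
by apply: le_trans (le_ereal_sup_range u 0%R); rewrite lee_fin.
Qed.

Lemma le_lpR p u v : 1 <= p -> (forall k, 0 <= u k <= v k)%R ->
  lpR p u <= lpR p v.
Proof.
case: p => [q| |] //= q1 uv; last first.
  apply: ge_ereal_sup => _ [k _ <-]; apply: le_trans (le_ereal_sup_range v k).
  by case/andP: (uv k).
rewrite lee_fin in q1; have q0 : (0 <= q)%R by lra.
apply: gt0_ler_poweR; rewrite ?invr_ge0//.
- by rewrite in_itv/= leey andbT esum_ge0// => k _; rewrite lee_fin powR_ge0.
- by rewrite in_itv/= leey andbT esum_ge0// => k _; rewrite lee_fin powR_ge0.
apply: le_esum => k _; rewrite lee_fin; case/andP: (uv k) => u0 uvk.
by rewrite ge0_ler_powR// nnegrE// (le_trans u0).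
Qed.

Lemma lpR_term p u k : 1 <= p -> (forall k, 0 <= u k)%R -> (u k)%:E <= lpR p u.
Proof.
case: p => [q| |] //= q1 u0; last exact: le_ereal_sup_range.
rewrite lee_fin in q1; have q0 : (0 < q)%R by lra.
have -> : (u k)%:E = poweR (u k `^ q)%:E q^-1.
  by rewrite poweR_EFin -powRrM divff ?gt_eqF// powRr1.
apply: gt0_ler_poweR; rewrite ?invr_ge0 ?(ltW q0)//.
- by rewrite in_itv/= leey andbT lee_fin powR_ge0.
- by rewrite in_itv/= leey andbT esum_ge0// => j _; rewrite lee_fin powR_ge0.
by apply: (esum_term (a := fun k => (u k `^ q)%:E)) => j; rewrite lee_fin powR_ge0.
Qed.

Lemma lpRZ p u (a : R) : 1 <= p -> (0 <= a)%R -> (forall k, 0 <= u k)%R ->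
  lpR p (fun k => a * u k)%R = a%:E * lpR p u.
Proof.
case: p => [q| |] //= q1 a0 u0; last first.
  rewrite -ereal_supZl//; last by apply/set0P; exists (u 0%R)%:E, 0%R.
  by rewrite image_comp; congr ereal_sup; apply: eq_imagel => k _.
rewrite lee_fin in q1; have q0 : (0 < q)%R by lra.
under eq_esum do rewrite powRM// EFinM.
rewrite esumZl ?lee_fin ?powR_ge0//; last by move=> k; rewrite lee_fin powR_ge0.
rewrite poweRM ?lee_fin ?powR_ge0 ?esum_ge0//; last first.
  by move=> k _; rewrite lee_fin powR_ge0.
by rewrite poweR_EFin -powRrM divff ?gt_eqF// powRr1.
Qed.

Lemma lpR_shift p u m : lpR p (fun i => u (i - m)%R) = lpR p u.
Proof.
case: p => [q| |] /=.
- by rewrite (esum_subl (fun i => (u i `^ q)%:E)).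
- congr ereal_sup; apply/seteqP; split => _ [k _ <-] /=; first by exists (k - m)%R.
  by exists (k + m)%R => //; rewrite addrK.
- congr ereal_sup; apply/seteqP; split => _ [k _ <-] /=; first by exists (k - m)%R.
  by exists (k + m)%R => //; rewrite addrK.
Qed.

Lemma lpR_delta p l (t : R) : 1 <= p -> (0 <= t)%R ->
  lpR p (fun i => if i == l then t else 0%R) <= t%:E.
Proof.
case: p => [q| |] //= q1 t0; last first.
  by apply: ge_ereal_sup => _ [k _ <-]; case: ifP.
rewrite lee_fin in q1; have q0 : (0 < q)%R by lra.
have -> : t%:E = poweR (t `^ q)%:E q^-1.
  by rewrite poweR_EFin -powRrM divff ?gt_eqF// powRr1.
rewrite (_ : \esum_(_ in _) _ = (t `^ q)%:E)//.
rewrite -(@esum_set1 _ _ l (fun=> (t `^ q)%:E)) ?lee_fin ?powR_ge0//.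
rewrite [RHS]esum_mkcond; apply: eq_esum => i _; rewrite in_set1.
by case: ifP => // _; rewrite powR0// gt_eqF.
Qed.

(** For finite exponent q, let s be the sum of u^q over a finite set. Writing u^q = u^(q-1) u,
    bounding the last factor by the sum of the [v m] and applying Hoelder to each [m] gives s <=
    s^((q-1)/q) [Lam]. Since s is finite it can be divided out, leaving s^(1/q) <= [Lam]. *)
Lemma lpR_minkowski (I : choiceType) p (u : G -> R) (v : I -> G -> R) :
  1 <= p -> (forall k, 0 <= u k)%R -> (forall m k, 0 <= v m k)%R ->
  (forall k, (u k)%:E <= \esum_(m in [set: I]) (v m k)%:E) ->
  lpR p u <= \esum_(m in [set: I]) lpR p (v m).
Proof.
move=> p1 u0 v0 uv.
have Lam0 : 0 <= \esum_(m in [set: I]) lpR p (v m).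
  by apply: esum_ge0 => m _; apply: lpR_ge0.
have [Lamoo|] := ltP (\esum_(m in [set: I]) lpR p (v m)) +oo; last first.
  by rewrite leye_eq => /eqP ->; rewrite leey.
have lamfin m : lpR p (v m) \is a fin_num.
  rewrite ge0_fin_numE ?lpR_ge0//; apply: le_lt_trans Lamoo.
  by apply: (esum_term (a := fun m => lpR p (v m))) => j; apply: lpR_ge0.
case: p p1 Lam0 Lamoo lamfin => [q| |] // p1 Lam0 Lamoo lamfin; last first.
  apply: ge_ereal_sup => _ [k _ <-]; apply: le_trans (uv k) _.
  by apply: le_esum => m _; apply: (lpR_term (p := +oo)).
have q1 : (1 <= q)%R by rewrite -lee_fin.
have q0 : (0 < q)%R by lra.
set Lam := \esum_(m in _) _ in Lam0 Lamoo *.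
have Lamfin : Lam \is a fin_num by rewrite ge0_fin_numE.
suff key : \esum_(k in [set: G]) (u k `^ q)%:E <= poweR Lam q.
  have := @gt0_ler_poweR _ q^-1 _ _ _ _ _ key.
  rewrite -poweRrM divff ?gt_eqF// poweRe1//; apply.
  - by rewrite invr_ge0 ltW.
  - by rewrite in_itv/= leey andbT esum_ge0// => k _; rewrite lee_fin powR_ge0.
  - by rewrite in_itv/= leey andbT poweR_ge0.
apply: esum_le_fset => B; rewrite sumEFin.
set s := (\sum_(i <- B) u i `^ q)%R.
have : (0 <= s)%R by apply: sumr_ge0 => i _; rewrite powR_ge0.
rewrite le_eqVlt => /predU1P[<-|s0]; first exact: poweR_ge0.
pose U := (s `^ q^-1)%R.
have U0 : (0 < U)%R by rewrite powR_gt0.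
have Uq : (U `^ q = s)%R by rewrite /U -powRrM mulVf ?gt_eqF// powRr1// ltW.
have hoel m : ((\sum_(i <- B) u i `^ (q - 1) * v m i)%:E <=
    (U `^ (q - 1))%:E * lpR q%:E (v m)).
  have L0 : 0 <= lpR q%:E (v m) by apply: lpR_ge0.
  (* [hoelder_seq] divides by its bounds, so a family [v m] of norm 0 is treated apart: all its
     values vanish. *)
  move: L0 (lamfin m); rewrite le_eqVlt => /predU1P[L0 _|L0 Lfin].
    rewrite -L0 mule0 lee_fin big1// => i _.
    have : ((v m i)%:E <= 0) by rewrite L0; apply: lpR_term.
    rewrite lee_fin => vm0; have -> : v m i = 0%R by apply/le_anti; rewrite vm0 v0.
    by rewrite mulr0.
  rewrite -(fineK Lfin) -EFinM lee_fin; apply: hoelder_seq => //.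
  - by rewrite -lte_fin fineK.
  - by rewrite Uq.
  - rewrite -lee_fin -poweR_EFin fineK// /lpR -poweRrM mulVf ?gt_eqF// poweRe1; last first.
      by apply: esum_ge0 => k _; rewrite lee_fin powR_ge0.
    rewrite -sumEFin; apply: (esum_fset_le (a := fun k => (v m k `^ q)%:E)).
    by move=> k; rewrite lee_fin powR_ge0.
have sle : s%:E <= (U `^ (q - 1))%:E * Lam.
  apply: (@le_trans _ _ (\sum_(i <- B) ((u i `^ (q - 1))%:E * \esum_(m in [set: I]) (v m i)%:E))).
    rewrite /s -sumEFin; apply: lee_sum => i _.
    by rewrite -mulr_powRB1// mulrC EFinM lee_wpmul2l// lee_fin powR_ge0.
  rewrite (eq_bigr (fun i => \esum_(m in [set: I]) ((u i `^ (q - 1))%:E * (v m i)%:E))); last first.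
    by move=> i _; rewrite esumZl ?lee_fin ?powR_ge0// => m; rewrite lee_fin.
  rewrite -esum_sum; last by move=> *; rewrite mule_ge0 ?lee_fin ?powR_ge0.
  rewrite /Lam -esumZl ?lee_fin ?powR_ge0//; last by move=> m; apply: lpR_ge0.
  apply: le_esum => m _; under eq_bigr do rewrite -EFinM.
  by rewrite sumEFin.
have UL : (U <= fine Lam)%R.
  move: sle; rewrite -(fineK Lamfin) -EFinM lee_fin.
  by rewrite -Uq -mulr_powRB1 ?(ltW U0)// mulrC ler_pM2l// powR_gt0.
rewrite -(fineK Lamfin) poweR_EFin lee_fin -Uq ge0_ler_powR ?nnegrE ?(ltW q0) ?(ltW U0)//.
by rewrite fine_ge0.
Qed.

End ScalarLp.

(** * Exponential windows and weights *)

Section ExponentialWindow.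
Context {R : realType} {c : nat}.
Implicit Types (m n : Zc c) (q r : R).

Definition l1len (m : Zc c) : nat := \sum_(i < c) `|m ord0 i|%N.

Lemma l1len0 : l1len 0 = 0%N.
Proof. by rewrite /l1len big1// => i _; rewrite mxE. Qed.

Lemma l1lenN m : l1len (- m) = l1len m.
Proof. by apply: eq_bigr => i _; rewrite mxE abszN. Qed.

Lemma l1lenD m n : (l1len (m + n)%R <= l1len m + l1len n)%N.
Proof.
rewrite /l1len -big_split/=; apply: leq_sum => i _; rewrite mxE.
by move: (m ord0 i) (n ord0 i) => a b; lia.
Qed.

(** [window q (i - k)] is phi_k (i) of the opening comment. *)
Definition window q m : R := q ^+ l1len m.

Lemma window0 q : window q 0 = 1.
Proof. by rewrite /window l1len0. Qed.

Lemma window_ge0 q m : 0 <= q -> 0 <= window q m.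
Proof. by move=> q0; apply: exprn_ge0. Qed.

Lemma window_le1 q m : 0 <= q <= 1 -> window q m <= 1.
Proof. by move=> /andP[q0 q1]; apply: exprn_ile1. Qed.

Lemma windowN q m : window q (- m) = window q m.
Proof. by rewrite /window l1lenN. Qed.

(** By the triangle inequality for [l1len], window (n) window (m - n) <= window (m), so window (n) -
    window (m) <= (1 - window (m - n)) window (n). Adding the other window to the right side makes
    the bound symmetric. *)
Lemma window_diff q m n : 0 <= q <= 1 ->
  `|window q m - window q n| <=
  (1 - window q (m - n)) * (window q m + window q n).
Proof.
move=> /[dup] q01 /andP[q0 q1].
have step m1 n1 : window q n1 - window q m1 <=
    (1 - window q (m1 - n1)) * (window q m1 + window q n1).
  have h : window q n1 * window q (m1 - n1) <= window q m1.
    rewrite /window -exprD ler_wiXn2l//.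
    by rewrite -{1}(subrKC n1 m1) l1lenD.
  have := window_le1 (m1 - n1) q01.
  have := window_ge0 m1 q0; nra.
have h1 := step m n; have := step n m; rewrite -(opprB m n) windowN => h2.
by rewrite ler_norml; apply/andP; split; lra.
Qed.

(** Bernoulli's inequality. *)
Lemma one_sub_window q m : 0 <= q <= 1 -> 1 - window q m <= (l1len m)%:R * (1 - q).
Proof.
move=> /[dup] q01 /andP[q0 q1]; rewrite /window; elim: (l1len m) => [|k IH].
  by rewrite expr0 mul0r subrr.
rewrite exprS -natr1.
have := exprn_ge0 k q0; have := exprn_ile1 k q0 q1; nra.
Qed.

End ExponentialWindow.

(** * Summability of windows against the weight *)

Section WindowSum.
Context {R : realType}.

Lemma esum_int_geometric (r : R) : 0 <= r < 1 ->
  (\esum_(z in [set: int]) (r ^+ `|z|%N)%:E < +oo)%E.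
Proof.
move=> /[dup] r01 /andP[r0 r1].
have P0 (z : int) : (0 <= (r ^+ `|z|%N)%:E)%E by rewrite lee_fin exprn_ge0.
rewrite (esumID (range Posz))//.
have geo := le_lt_trans (esum_geometric r01) (ltry _).
apply: lte_add_pinfty.
  by rewrite setTI esum_image//= => x y _ _ [].
have -> : [set: int] `&` ~` range Posz = range Negz.
  apply/seteqP; split => [[n|n]|z] /=.
  - by move=> [_ h]; exfalso; apply: h; exists n.
  - by move=> _; exists n.
  - by move=> [n _ <-]; split => // -[].
rewrite esum_image; last by move=> x y _ _ [].
apply: le_lt_trans geo; apply: le_esum => n _ /=.
(* [Negz n] is -(n + 1), so its term carries one more factor [r], which is at most 1. *)
by rewrite lee_fin exprS ler_piMl ?exprn_ge0// ltW.
Qed.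

(** Splitting off the first coordinate turns the window into a product, so the sum is the geometric
    sum over the integers times the sum in one dimension less. *)
Lemma esum_window (r : R) c : 0 <= r < 1 ->
  (\esum_(m in [set: Zc c]) (window r m)%:E < +oo)%E.
Proof.
move=> /[dup] r01 /andP[r0 r1]; elim: c => [|c IH].
  rewrite (_ : [set: Zc 0] = [set 0]).
    by rewrite esum_set1 ?ltry// lee_fin window_ge0.
  by apply/seteqP; split => // x _ /=; apply: thinmx0.
pose f (x : int * Zc c) : Zc c.+1 := row_mx (const_mx x.1 : 'rV_1) x.2.
have fE x : window r (f x) = r ^+ `|x.1|%N * window r x.2.
  rewrite /window -exprD; congr (_ ^+ _).
  have e1 : f x ord0 (@lshift 1 c ord0) = x.1 
    by apply: etrans (row_mxEl _ _ _ _) _; rewrite mxE.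
  have e2 i : f x ord0 (@rshift 1 c i) = x.2 ord0 i by exact: row_mxEr.
  rewrite /l1len [LHS](@big_split_ord _ _ _ 1 c) big_ord1 e1.
  by congr (_ + _)%N; apply: eq_bigr => i _; rewrite e2.
rewrite (reindex_esum ([set: int] `*`` (fun=> [set: Zc c])) _ f); last first.
  split => //=; last first.
    move=> y _ /=; exists (lsubmx (y : 'rV_(1 + c)) 0 0, rsubmx (y : 'rV_(1 + c))) => //.
    rewrite /f /= (_ : const_mx _ = lsubmx (y : 'rV_(1 + c))) ?hsubmxK//.
    by apply/matrixP => i j; rewrite mxE !ord1.
  move=> [x1 x2] [y1 y2] _ _ /= fxy.
  have [/matrixP/(_ 0 0)] := @eq_row_mx _ 1 1 c _ _ _ _ fxy.
  by rewrite !mxE /= => -> ->.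
under eq_esum do rewrite fE EFinM.
have e0 (z : int) : (0 <= (r ^+ `|z|%N)%:E)%E by rewrite lee_fin exprn_ge0.
have w0 (m : Zc c) : (0 <= (window r m)%:E)%E by rewrite lee_fin window_ge0.
rewrite -(esum_esum (a := fun z m => ((r ^+ `|z|%N)%:E * (window r m)%:E)%E)); last first.
  by move=> *; rewrite mule_ge0.
under eq_esum do rewrite esumZl// muleC.
rewrite esumZl ?esum_ge0//.
apply: lte_mul_pinfty; rewrite ?ge0_fin_numE ?esum_ge0//.
exact: esum_int_geometric.
Qed.

Context {c : nat} (g : Zc c -> R).
Hypothesis wg : is_weight g.

(** By condition (e) the n-th root of g(nt) is below 1 / r from some [N] on. In the constant, 1
    serves these n and the finite sum serves n < N. *)
Lemma weight_subexp_ray (r : R) (t : Zc c) : 0 < r < 1 ->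
  exists2 K : R, 0 <= K & forall n, g (t *+ n) <= K * r^-1 ^+ n.
Proof.
case: wg => g0 _ _ g1 grs /andP[r0 r1].
have rV1 : 1 < r^-1 by rewrite invf_gt1.
have ge0 n : 0 <= g n by apply: le_trans (g1 n).
have [N _ hN] := cvgr_lt 1 (grs t) _ rV1.
exists (1 + \sum_(n < N) g (t *+ n)); first by rewrite addr_ge0// sumr_ge0.
move=> n.
have rn : 1 <= r^-1 ^+ n by rewrite exprn_ege1// ltW.
have s0 : 0 <= \sum_(n < N) g (t *+ n) by rewrite sumr_ge0.
have [nN|Nn] := ltnP n N.
  have : g (t *+ n) <= \sum_(n < N) g (t *+ n).
    by rewrite (bigD1 (Ordinal nN))//= lerDl sumr_ge0.
  by nra.
have : g (t *+ n) <= r^-1 ^+ n.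
  (* For n = 0 the root has exponent 0^-1 = 0 and carries no information; [g 0 = 1] is used
     instead. *)
  case: n Nn rn => [|n] Nn rn; first by rewrite mulr0n g0.
  have /ltW h := hN _ Nn.
  rewrite -[leLHS]powRr1// -(@mulVf _ n.+1%:R) ?pnatr_eq0// powRrM.
  rewrite powR_mulrn ?powR_ge0//.
  by apply: lerXn2r; rewrite ?nnegrE ?powR_ge0 ?invr_ge0 ?(ltW r0).
by nra.
Qed.

(** Write m as a sum of multiples of unit vectors: submultiplicativity reduces to the coordinate
    rays, and the symmetry of [g] covers negative coordinates. *)
Lemma weight_subexp (r : R) : 0 < r < 1 ->
  exists2 K : R, 0 <= K & forall m, g m <= K * r^-1 ^+ l1len m.
Proof.
move=> r01; case: (wg) => g0 gM gN g1 _; case/andP: (r01) => r0 r1.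
have ge0 n : 0 <= g n by apply: le_trans (g1 n).
have /choice[K hK] (i : 'I_c) : exists K : R, 0 <= K /\
    forall z : int, g (z *: delta_mx 0 i) <= K * r^-1 ^+ `|z|%N.
  have [K K0 hK] := weight_subexp_ray (delta_mx 0 i) r01.
  exists K; split => // -[n|n].
    by rewrite -[Posz n]natz scaler_nat natz.
  by rewrite NegzE -[Posz _]natz scaleNr gN scaler_nat natz abszN.
exists (\prod_i K i); first by apply: prodr_ge0 => i _; have [] := hK i.
move=> m.
have -> : \prod_i K i * r^-1 ^+ l1len m = \prod_i (K i * r^-1 ^+ `|m ord0 i|%N).
  by rewrite big_split/= -(big_morph _ (exprD r^-1) (expr0 _)).
rewrite {1}(row_sum_delta m).
elim/big_rec2: _ => [|i y x _ IH]; first by rewrite g0.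
apply: le_trans (gM _ _) _; apply: ler_pM => //.
by have [_] := hK i.
Qed.

(** The square leaves a spare factor: g(m) grows at most like r^(-|m|), so its product with r^(2|m|)
    is still O(r^|m|). *)
Lemma esum_weight_window (r : R) : 0 < r < 1 ->
  (\esum_(m in [set: Zc c]) (g m * window (r ^+ 2) m)%:E < +oo)%E.
Proof.
move=> r01; case/andP: (r01) => r0 r1; have [K K0 hK] := weight_subexp r01.
have w0 (m : Zc c) : 0 <= window r m by rewrite window_ge0// ltW.
apply: (@le_lt_trans _ _ (\esum_(m in [set: Zc c]) (K%:E * (window r m)%:E))%E).
  apply: le_esum => m _; rewrite -EFinM lee_fin.
  have -> : window (r ^+ 2) m = window r m * window r m.
    by rewrite /window -exprM mulnC exprM expr2.
  rewrite mulrA ler_wpM2r// (le_trans (ler_wpM2r (w0 m) (hK m)))//.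
  by rewrite /window exprVn mulfVK ?expf_neq0 ?gt_eqF.
rewrite esumZl ?lee_fin//.
by apply: lte_mul_pinfty => //; apply: esum_window; rewrite ltW.
Qed.

End WindowSum.

(** * Unordered sums *)

Section NormedFacts.
Context {R : realType} {X : completeNormedModType R[i]}.
Implicit Types (a : R[i]).

Lemma normE_nrm (x : X) : `|x| = (nrm x)%:C.
Proof.
have := normr_ge0 x; rewrite /nrm; case: `|x| => re im.
by rewrite lecE /= => /andP[/eqP -> _].
Qed.

Lemma normE_cabs a : `|a| = (cabs a)%:C.
Proof.
have := normr_ge0 a; rewrite /cabs; case: `|a| => re im.
by rewrite lecE /= => /andP[/eqP -> _].
Qed.

Lemma nrm_ge0 (x : X) : 0 <= nrm x.
Proof. by have := normr_ge0 x; rewrite normE_nrm lecR. Qed.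

Lemma cabs_ge0 a : 0 <= cabs a.
Proof. by have := normr_ge0 a; rewrite normE_cabs lecR. Qed.

Lemma nrmD (x y : X) : nrm (x + y) <= nrm x + nrm y.
Proof. by have := ler_normD x y; rewrite !normE_nrm -rmorphD lecR. Qed.

Lemma nrmN (x : X) : nrm (- x) = nrm x.
Proof. by rewrite /nrm normrN. Qed.

Lemma nrmB (x y : X) : nrm (x - y) <= nrm x + nrm y.
Proof. by rewrite -(nrmN y) nrmD. Qed.

Lemma nrmZ a (x : X) : nrm (a *: x) = cabs a * nrm x.
Proof. by have := normrZ a x; rewrite normE_cabs !normE_nrm -rmorphM => /complexI. Qed.

Lemma cabs_real (r : R) : cabs r%:C = `|r|.
Proof. by have := normc_def r%:C; rewrite /cabs => ->/=; rewrite expr0n addr0 sqrtr_sqr. Qed.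

Lemma nrm0 : nrm (0 : X) = 0.
Proof. by rewrite /nrm normr0. Qed.

Lemma cabs0 : cabs (0 : R[i]) = 0.
Proof. by rewrite /cabs normr0. Qed.

Lemma nrm0_eq0 (x : X) : nrm x <= 0 -> x = 0.
Proof.
move=> h; apply/normr0_eq0; rewrite normE_nrm.
by rewrite (_ : nrm x = 0)//; apply/le_anti; rewrite h nrm_ge0.
Qed.

Lemma nrm_sum (I : Type) (s : seq I) (F : I -> X) :
  nrm (\sum_(i <- s) F i) <= \sum_(i <- s) nrm (F i).
Proof.
elim: s => [|i s IH]; first by rewrite !big_nil nrm0.
by rewrite !big_cons (le_trans (nrmD _ _))// lerD2l.
Qed.

(** Over [R[i]] the radii of balls are complex, but [0 < e] forces [e] to be real, so real radii
    suffice. *)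
Lemma cvg_nrmP (u : nat -> X) (l : X) : (u @ \oo --> l) <->
  forall e : R, 0 < e -> exists N, forall n, (N <= n)%N -> nrm (l - u n) < e.
Proof.
split=> [/cvgrPdist_lt ul e e0|h].
  have [|N _ hN] := ul e%:C; first by rewrite ltcR.
  by exists N => n /hN /=; rewrite normE_nrm ltcR.
apply/cvgrPdist_lt => e e0.
have [re0 eE] : 0 < complex.Re e /\ e = (complex.Re e)%:C.
  by case: e e0 => re im; rewrite ltcE /= => /andP[/eqP -> ?].
have [N hN] := h _ re0; exists N => // n /= /hN.
by rewrite eE normE_nrm ltcR.
Qed.

Lemma unord_sum_le (I : choiceType) (F : I -> X) (l : X) (f : I -> R) :
  unord_sum_to F l -> (forall i, nrm (F i) <= f i) ->
  ((nrm l)%:E <= \esum_(i in [set: I]) (f i)%:E)%E.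
Proof.
move=> Fl Ff; apply/lee_addgt0Pr => e e0; have [A hA] := Fl e e0.
have f0 i : 0 <= f i by apply: le_trans (Ff i); exact: nrm_ge0.
apply: (@le_trans _ _ (\sum_(i <- A) (f i)%:E + e%:E)%E); last first.
  by apply: leeD2r; apply: esum_fset_le => i; rewrite lee_fin.
rewrite sumEFin -EFinD lee_fin.
have := hA A (fsubset_refl A).
have : \sum_(i <- A) nrm (F i) <= \sum_(i <- A) f i by apply: ler_sum.
have := nrm_sum A F.
have := nrmD (l - \sum_(i <- A) F i) (\sum_(i <- A) F i); rewrite subrK.
lra.
Qed.

Lemma unord_sum_lin (I : choiceType) (F G : I -> X) (l l' : X) a :
  unord_sum_to F l -> unord_sum_to G l' ->
  unord_sum_to (fun i => a *: F i + G i) (a *: l + l').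
Proof.
move=> Fl Gl' e e0.
have a1 : 0 < cabs a + 1 by have := cabs_ge0 a; lra.
have [|A hA] := Fl (e / 2 / (cabs a + 1)); first by rewrite divr_gt0// divr_gt0.
have [|A' hA'] := Gl' (e / 2); first by rewrite divr_gt0.
exists (A `|` A')%fset => B /fsubUsetP[AB A'B].
rewrite big_split/= -scaler_sumr opprD addrACA -scalerBr.
apply: le_lt_trans (nrmD _ _) _; rewrite nrmZ.
have := hA _ AB; rewrite ltr_pdivlMr//.
have := hA' _ A'B; have := nrm_ge0 (l - \sum_(i <- B) F i).
have := cabs_ge0 a; nra.
Qed.

Lemma cvg_series_le (F : nat -> X) (l : X) (f : nat -> R) :
  (fun n : nat => \sum_(i < n) F i) @ \oo --> l -> (forall i, nrm (F i) <= f i) ->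
  ((nrm l)%:E <= \esum_(i in [set: nat]) (f i)%:E)%E.
Proof.
move=> /cvg_nrmP Fl Ff; apply/lee_addgt0Pr => e e0; have [N hN] := Fl e e0.
have f0 i : 0 <= f i by apply: le_trans (Ff i); exact: nrm_ge0.
apply: (@le_trans _ _ (\sum_(i < N) (f i)%:E + e%:E)%E); last first.
  apply: leeD2r; rewrite -nneseries_esumT; last by move=> i; rewrite lee_fin.
  rewrite -(big_mkord xpredT (fun i => (f i)%:E)).
  by apply: nneseries_lim_ge => i _ _; rewrite lee_fin.
rewrite sumEFin -EFinD lee_fin.
have := hN N (leqnn N).
have : \sum_(i < N) nrm (F i) <= \sum_(i < N) f i by apply: ler_sum.
have := nrm_sum (index_enum 'I_N) F.
have := nrmD (l - \sum_(i < N) F i) (\sum_(i < N) F i); rewrite subrK.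
lra.
Qed.

(** Bounds the error of a finite partial sum of an iterated series by the norms left out. For empty
    [B] this is the triangle inequality, applied twice. Otherwise remove a pair (m0, i0) from [B],
    replace that term by 0 and subtract it from [S m0] and from [l]: both sides keep their value. *)
Lemma unord_fubini (I : choiceType) (G : I * nat -> X) (S : I -> X) (l : X)
    (B : {fset I * nat}) :
  (forall m, (fun n : nat => \sum_(i < n) G (m, nat_of_ord i)) @ \oo --> S m) ->
  unord_sum_to S l ->
  ((nrm (l - \sum_(x <- B) G x))%:E <=
   \esum_(x in [set: I * nat]) (if x \in B then 0 else (nrm (G x))%:E))%E.
Proof.
elim/finSet_rect: B G S l => B IH G S l GS Sl.
have [B0|[[m0 i0] x0B]] := fset_0Vmem B.
  rewrite {1}B0 big_seq_fset0 subr0.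
  rewrite [leRHS](_ : _ = \esum_(x in [set: I * nat]) (nrm (G x))%:E)%E; last first.
    by apply: eq_esum => x _; rewrite B0 in_fset0.
  pose t m := (\esum_(i in [set: nat]) (nrm (G (m, i)))%:E)%E.
  have t0 m : (0 <= t m)%E by apply: esum_ge0 => i _; rewrite lee_fin nrm_ge0.
  have St m : ((nrm (S m))%:E <= t m)%E.
    exact: (@cvg_series_le (fun i => G (m, i)) (S m) (fun i => nrm (G (m, i)))).
  apply: (@le_trans _ _ (\esum_(m in [set: I]) (nrm (S m))%:E)%E).
    exact: (unord_sum_le (f := fun m => nrm (S m)) Sl).
  apply: le_trans (le_esum (fun m _ => St m)) _.
  rewrite /t (esum_esum (J := fun=> setT)) => [|*]; last by rewrite lee_fin nrm_ge0.
  rewrite le_eqVlt; apply/orP; left; apply/eqP.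
  rewrite (_ : _ `*`` _ = setT); last by apply/seteqP; split.
  by apply: eq_esum => -[].
set x0 := (m0, i0) in x0B *.
pose G2 x := if x == x0 then 0 else G x.
pose S2 m := if m == m0 then S m - G x0 else S m.
have := IH (B `\ x0)%fset (fproperD1 x0B) G2 S2 (l - G x0).
have -> : \sum_(x <- (B `\ x0)%fset) G2 x = \sum_(x <- (B `\ x0)%fset) G x.
  rewrite big_seq [RHS]big_seq; apply: eq_bigr => x; rewrite !inE /G2 => /andP[/negPf ->].
  by [].
have -> : l - G x0 - \sum_(x <- (B `\ x0)%fset) G x = l - \sum_(x <- B) G x.
  by rewrite (big_fsetD1 _ x0B)/= opprD addrA.
have -> : (\esum_(x in [set: I * nat]) (if x \in (B `\ x0)%fset then 0 else (nrm (G2 x))%:E) =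
   \esum_(x in [set: I * nat]) (if x \in B then 0 else (nrm (G x))%:E))%E.
  apply: eq_esum => x _; rewrite !inE /G2; case: eqVneq => [->|_] //=.
  by rewrite x0B nrm0.
apply.
- move=> m; rewrite /S2 /G2; case: (eqVneq m m0) => [->|mm0]; last first.
    under eq_fun do under eq_bigr do rewrite xpair_eqE (negPf mm0).
    exact: GS.
  have /cvg_nrmP h := GS m0; apply/cvg_nrmP => e e0; have [N hN] := h e e0.
  exists (maxn N i0.+1) => n; rewrite geq_max => /andP[Nn i0n].
  have := hN n Nn; rewrite (bigD1 (Ordinal i0n))//= [X in _ -> nrm (_ - X) < _](bigD1 (Ordinal i0n))//=.
  rewrite eqxx add0r opprD addrA.
  rewrite (eq_bigr (fun i : 'I_n => if (m0, nat_of_ord i) == x0 then 0 else G (m0, nat_of_ord i)))//.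
  move=> i; rewrite -val_eqE /= => ii0; rewrite xpair_eqE eqxx/= (negPf ii0)//.
- move=> e e0; have [A hA] := Sl e e0; exists (m0 |` A)%fset => B' AB'.
  have m0B' : m0 \in B' by apply: (fsubsetP AB'); rewrite !inE eqxx.
  have := hA B' (fsubset_trans (fsubsetU1 _ _) AB').
  rewrite (big_fsetD1 _ m0B')/= [X in _ -> nrm (_ - X) < _](big_fsetD1 _ m0B')/= /S2 eqxx.
  rewrite (_ : \sum_(i <- (B' `\ m0)%fset) (if i == m0 then S i - G x0 else S i) =
     \sum_(i <- (B' `\ m0)%fset) S i); last first.
    by rewrite big_seq [RHS]big_seq; apply: eq_bigr => x; rewrite !inE => /andP[/negPf ->].
  by congr (nrm _ < _); rewrite !opprD opprK !addrA; congr (_ + _); rewrite addrAC subrK.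
Qed.

End NormedFacts.

(** * Nuclear operators *)

Section Nuclear.
Context {R : realType} {X : completeNormedModType R[i]}.

Definition linear_map (D : X -> X) : Prop :=
  forall (a : R[i]) x y, D (a *: x + y) = a *: D x + D y.

Lemma linear_map0 D : linear_map D -> D 0 = 0.
Proof. by move=> /(_ (-1) 0 0); rewrite scaler0 addr0 scaleN1r addNr. Qed.

Lemma lin_functional0 (f : X -> R[i]) : lin_functional f -> f 0 = 0.
Proof. by move=> /(_ (-1) 0 0); rewrite scaler0 addr0 mulN1r addNr. Qed.

Lemma dual_norm_ge0 (f : X -> R[i]) : (0 <= dual_norm f)%E.
Proof. by apply: le_ereal_inf_tmp => _ [M [M0 _] <-]; rewrite lee_fin. Qed.

Lemma dual_norm_le (f : X -> R[i]) (M : R) : 0 <= M ->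
  (forall x, cabs (f x) <= M * nrm x) -> (dual_norm f <= M%:E)%E.
Proof. by move=> M0 fM; apply: ereal_inf_lbound; exists M. Qed.

Lemma dual_norm_bound (f : X -> R[i]) (d : R) x : lin_functional f ->
  dual_norm f = d%:E -> cabs (f x) <= d * nrm x.
Proof.
move=> lf fd; have [x0|x0] := leP (nrm x) 0.
  by rewrite (nrm0_eq0 x0) lin_functional0// cabs0 nrm0 mulr0.
rewrite -ler_pdivrMr// -lee_fin -fd; apply: le_ereal_inf_tmp => _ [M [M0 fM] <-].
by rewrite lee_fin ler_pdivrMr.
Qed.

(* [dual_norm] may be infinite when the paired vector vanishes (then +oo * 0 = 0);
   recording the products as reals [w i] takes care of this degenerate case. *)
Definition nuclear_data (A : X -> X) (a : nat -> X -> R[i]) (y : nat -> X)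
    (w : nat -> R) (s : R) : Prop :=
  [/\ (forall i, lin_functional (a i)),
      (forall i, (dual_norm (a i) * (nrm (y i))%:E = (w i)%:E)%E),
      (\esum_(i in [set: nat]) (w i)%:E <= s%:E)%E &
      (forall x, (fun n : nat => \sum_(i < n) a i x *: y i) @ \oo --> A x)].

(** The slack [b < b'] selects a representation near the infimum; its finite total makes every
    product finite, hence a real weight. *)
Lemma nuclear_data_exists (A : X -> X) (b b' : R) :
  (nuclear_norm A <= b%:E)%E -> b < b' -> exists a y w, nuclear_data A a y w b'.
Proof.
move=> Ab bb'.
have t0 (ay : (nat -> X -> R[i]) * (nat -> X)) i :
    (0 <= dual_norm (ay.1 i) * (nrm (ay.2 i))%:E)%E.
  by rewrite mule_ge0 ?dual_norm_ge0// lee_fin nrm_ge0.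
have /ereal_inf_lt : (nuclear_norm A < b'%:E)%E by apply: le_lt_trans Ab _; rewrite lte_fin.
move=> [_ [ay [la sA cA] <-]]; rewrite nneseries_esumT// => sb'.
have fin i : (dual_norm (ay.1 i) * (nrm (ay.2 i))%:E)%E \is a fin_num.
  rewrite ge0_fin_numE//; apply: le_lt_trans (lt_trans sb' (ltry _)).
  exact: (esum_term (a := fun i => (dual_norm (ay.1 i) * (nrm (ay.2 i))%:E)%E)).
exists ay.1, ay.2, (fun i => fine (dual_norm (ay.1 i) * (nrm (ay.2 i))%:E)).
split => // [i|]; first by rewrite fineK.
apply: ltW; apply: le_lt_trans sb'.
by rewrite le_eqVlt; apply/orP; left; apply/eqP; apply: eq_esum => i _; rewrite fineK.
Qed.

Section Data.
Context (A : X -> X) (a : nat -> X -> R[i]) (y : nat -> X) (w : nat -> R) (s : R).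
Hypothesis dA : nuclear_data A a y w s.

Lemma nuclear_data_ge0 i : 0 <= w i.
Proof.
case: dA => _ wE _ _; rewrite -lee_fin -wE mule_ge0 ?dual_norm_ge0//.
by rewrite lee_fin nrm_ge0.
Qed.

(** Precomposing the functionals with [D] costs a factor [d]. If [y i] is 0 the product is 0;
    otherwise finiteness of [w i] forces [a i] to be bounded. *)
Lemma nuclear_data_compl i (D : X -> X) (d : R) : 0 <= d ->
  (forall v, nrm (D v) <= d * nrm v) ->
  (dual_norm (fun v => a i (D v)) * (nrm (y i))%:E <= (w i * d)%:E)%E.
Proof.
move=> d0 Dd; case: dA => la wE _ _; have w0 := nuclear_data_ge0 i.
have [y0|y0] := leP (nrm (y i)) 0.
  have -> : nrm (y i) = 0 by apply/le_anti; rewrite y0 nrm_ge0.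
  by rewrite mule0 lee_fin mulr_ge0.
have := wE i; case E: (dual_norm (a i)) => [r| |].
- rewrite -EFinM => -[<-]; rewrite mulrAC [leRHS]EFinM.
  have r0 : 0 <= r by rewrite -lee_fin -E dual_norm_ge0.
  apply: lee_wpmul2r; first by rewrite lee_fin nrm_ge0.
  apply: dual_norm_le; first by rewrite mulr_ge0.
  move=> x; apply: le_trans (dual_norm_bound _ (la i) E) _.
  by rewrite -mulrA ler_wpM2l.
- by rewrite gt0_mulye ?lte_fin.
- by have := dual_norm_ge0 (a i); rewrite E.
Qed.

Lemma nuclear_data_term i x : nrm (a i x *: y i) <= w i * nrm x.
Proof.
case: dA => la wE _ _; rewrite nrmZ.
have [y0|y0] := leP (nrm (y i)) 0.
  have -> : nrm (y i) = 0 by apply/le_anti; rewrite y0 nrm_ge0.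
  by rewrite mulr0 mulr_ge0 ?nuclear_data_ge0 ?nrm_ge0.
have := wE i; case E: (dual_norm (a i)) => [r| |].
- rewrite -EFinM => -[<-]; rewrite mulrAC ler_wpM2r ?nrm_ge0//.
  exact: dual_norm_bound.
- by rewrite gt0_mulye ?lte_fin.
- by have := dual_norm_ge0 (a i); rewrite E.
Qed.

Lemma nuclear_data_bound x : nrm (A x) <= s * nrm x.
Proof.
have w0 := nuclear_data_ge0.
case: (dA) => la wE ws cA; rewrite -lee_fin.
apply: le_trans (@cvg_series_le _ _ (fun i => a i x *: y i) _ _ (cA x) (nuclear_data_term ^~ x)) _.
under eq_esum do rewrite mulrC EFinM.
rewrite esumZl ?lee_fin ?nrm_ge0//.
by rewrite mulrC EFinM lee_wpmul2l// lee_fin nrm_ge0.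
Qed.

(** Linearity passes from the partial sums to their pointwise limit, by a three-epsilon estimate. *)
Lemma nuclear_data_linear : linear_map A.
Proof.
case: (dA) => la wE ws cA c u v; apply/eqP; rewrite -subr_eq0; apply/eqP/nrm0_eq0.
apply/ler_addgt0Pr => e e0; rewrite add0r.
have c1 : 0 < cabs c + 1 by have := cabs_ge0 c; lra.
have /cvg_nrmP/(_ (e / 3)) := cA (c *: u + v).
rewrite divr_gt0// => /(_ isT)[N1 h1].
have /cvg_nrmP/(_ (e / 3 / (cabs c + 1))) := cA u.
rewrite !divr_gt0// => /(_ isT)[N2 h2].
have /cvg_nrmP/(_ (e / 3)) := cA v.
rewrite divr_gt0// => /(_ isT)[N3 h3].
pose n := maxn N1 (maxn N2 N3).
have := h1 n (leq_maxl _ _).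
have := h2 n (leq_trans (leq_maxl _ _) (leq_maxr _ _)); rewrite ltr_pdivlMr//.
have := h3 n (leq_trans (leq_maxr _ _) (leq_maxr _ _)).
have -> : \sum_(i < n) a i (c *: u + v) *: y i =
    c *: (\sum_(i < n) a i u *: y i) + \sum_(i < n) a i v *: y i.
  rewrite scaler_sumr -big_split/=; apply: eq_bigr => i _.
  by rewrite la scalerDl scalerA.
set su := \sum_(i < n) a i u *: y i; set sv := \sum_(i < n) a i v *: y i.
set P := A (c *: u + v) => hv hu huv.
have -> : P - (c *: A u + A v) = (P - (c *: su + sv)) - (c *: (A u - su) + (A v - sv)).
  rewrite scalerBr (addrACA (c *: A u)) -opprD (opprB (_ + _)).
  by rewrite addrACA (addrC (- (c *: su + sv))) addrACA subrr addr0.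
apply: le_trans (nrmB _ _) _.
have := nrmD (c *: (A u - su)) (A v - sv); rewrite nrmZ.
have := nrm_ge0 (A u - su); have := cabs_ge0 c; nra.
Qed.

End Data.

(** The representations of the [A m], precomposed with [D m], are merged into a single one indexed
    by [I * nat]. Its weights sum to at most [s], and [unord_fubini] shows that it converges to
    [E]. *)
Lemma nuclear_unord_sum (I : countType) (A D : I -> X -> X) (b d : I -> R)
    (E : X -> X) (s : \bar R) :
  (forall m, exists a y w, nuclear_data (A m) a y w (b m)) ->
  (forall m, linear_map (D m)) -> (forall m, 0 <= d m) ->
  (forall m v, nrm (D m v) <= d m * nrm v) ->
  (\esum_(m in [set: I]) (b m * d m)%:E <= s)%E -> (s < +oo)%E ->
  (forall v, unord_sum_to (fun m => A m (D m v)) (E v)) ->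
  nuclear E /\ (nuclear_norm E <= s)%E.
Proof.
move=> /choice[a /choice[y /choice[w dA]]] lD d0 Dd bds soo Esum.
pose J : countType := (I * nat)%type.
(* The pairs are enumerated by their codes; a number that codes no pair contributes a zero term. *)
pose a' n : X -> R[i] := if @pickle_inv J n is Some x
  then fun v => a x.1 x.2 (D x.1 v) else fun=> 0.
pose y' n : X := if @pickle_inv J n is Some x then y x.1 x.2 else 0.
pose f (x : J) := w x.1 x.2 * d x.1.
have w0 m i : 0 <= w m i by apply: nuclear_data_ge0 (dA m) i.
have f0 x : 0 <= f x by rewrite mulr_ge0.
have fs : (\esum_(x in [set: J]) (f x)%:E <= s)%E.
  apply: le_trans bds.
  rewrite (_ : [set: J] = [set: I] `*`` fun=> setT); last by apply/seteqP; split.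
  rewrite -(esum_esum (J := fun=> setT) (a := fun m i => (w m i * d m)%:E)); last first.
    by move=> *; rewrite lee_fin mulr_ge0.
  apply: le_esum => m _; under eq_esum do rewrite mulrC EFinM.
  rewrite esumZl ?lee_fin//; last by move=> i; rewrite lee_fin.
  by rewrite mulrC EFinM lee_wpmul2l ?lee_fin//; have [] := dA m.
have t0 n : (0 <= dual_norm (a' n) * (nrm (y' n))%:E)%E.
  by rewrite mule_ge0 ?dual_norm_ge0// lee_fin nrm_ge0.
have sum_le : (\sum_(n <oo) (dual_norm (a' n) * (nrm (y' n))%:E) <= s)%E.
  rewrite nneseries_esumT//; apply: le_trans fs.
  pose h n := (if @pickle_inv J n is Some x then (f x)%:E else 0)%E.
  have -> : (\esum_(x in [set: J]) (f x)%:E = \esum_(x in [set: J]) h (choice.pickle x))%E.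
    by apply: eq_esum => x _; rewrite /h choice.pickleK_inv.
  rewrite -(esum_image [set: J] choice.pickle h); last first.
    by move=> u v _ _; apply: (pcan_inj choice.pickleK).
  rewrite [leRHS]esum_mkcond; apply: le_esum => n _; rewrite /h /a' /y'.
  case E': (@pickle_inv J n) => [x|]; last by rewrite nrm0 mule0 if_same.
  rewrite ifT; first exact: nuclear_data_compl (dA x.1) _ _ _ (d0 _) (Dd _).
  by apply/mem_set; exists x => //; have := @pickle_invK J n; rewrite E'.
have rep : nuclear_rep E a' y'.
  split; first 2 last.
  - move=> v; apply/cvg_nrmP => e e0.
    pose G (x : J) := a x.1 x.2 (D x.1 v) *: y x.1 x.2.
    have Gf x : nrm (G x) <= nrm v * f x.
      apply: le_trans (nuclear_data_term (dA x.1) _ _) _.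
      by rewrite /f mulrCA ler_wpM2l// mulrC.
    have G0 x : (0 <= (nrm (G x))%:E)%E by rewrite lee_fin nrm_ge0.
    have Goo : (\esum_(x in [set: J]) (nrm (G x))%:E < +oo)%E.
      apply: (@le_lt_trans _ _ ((nrm v)%:E * s)%E).
        apply: (@le_trans _ _ (\esum_(x in [set: J]) ((nrm v)%:E * (f x)%:E))%E).
          by apply: le_esum => x _; rewrite -EFinM lee_fin.
        rewrite esumZl ?lee_fin ?nrm_ge0//.
        by apply: lee_wpmul2l => //; rewrite lee_fin nrm_ge0.
      by apply: lte_mul_pinfty => //; rewrite lee_fin nrm_ge0.
    have [A0 hA0] := esum_tail G0 Goo e0.
    (* From this index on, the first n terms include all pairs of [A0], so the n-th partial sum is a
       sum over a finite set [B] containing [A0]. *)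
    exists (\max_(x <- A0) (choice.pickle x).+1)%N => n Nn.
    pose r := pmap (@pickle_inv J) (iota 0 n).
    have ru : uniq r by apply: (pmap_uniq (@pickle_invK J)) (iota_uniq _ _).
    have mem_r x : (x \in r) = (choice.pickle x < n)%N.
      rewrite mem_pmap; apply/mapP/idP => [[j]|xn].
        rewrite mem_iota add0n => /andP[_ jn] xj.
        by have := @pickle_invK J j; rewrite -xj /= => ->.
      by exists (choice.pickle x); rewrite ?mem_iota ?choice.pickleK_inv.
    pose B := [fset x in r]%fset.
    have A0B : (A0 `<=` B)%fset.
      apply/fsubsetP => x xA; rewrite !inE mem_r; apply: leq_trans Nn.
      exact: (@leq_bigmax_seq _ _ xpredT (fun x : J => (choice.pickle x).+1)).
    have -> : \sum_(i < n) a' i v *: y' i = \sum_(x <- B) G x.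
      rewrite -(big_mkord xpredT (fun i => a' i v *: y' i)) /index_iota subn0.
      transitivity (\sum_(x <- r) G x).
        rewrite /r big_pmap; apply: eq_bigr => i _; rewrite /a' /y' /G.
        by case: pickle_inv => [x|] //=; rewrite scaler0.
      by apply: perm_big; apply: uniq_perm => [||x]; rewrite ?fset_uniq// !inE.
    rewrite -lte_fin; apply: le_lt_trans (hA0 B A0B).
    apply: (unord_fubini (S := fun m => A m (D m v))) (Esum v) => m.
    by have [_ _ _] := dA m; apply.
  - move=> n c u v; rewrite /a'; case: pickle_inv => [x|]; last by rewrite mulr0 addr0.
    by rewrite lD; have [-> _ _ _] := dA x.1.
  - exact: le_lt_trans sum_le soo.
split; first by exists a', y'.
by apply: le_trans sum_le; apply: ereal_inf_lbound; exists (a', y').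
Qed.

End Nuclear.

(** * A nuclear identity forces finite dimension *)

Section NuclearIdentity.
Context {R : realType} {X : completeNormedModType R[i]}.

Lemma esum_nat_tail (w : nat -> R) (e : R) : (forall i, 0 <= w i) ->
  (\esum_(i in [set: nat]) (w i)%:E < +oo)%E -> 0 < e ->
  exists N, (\esum_(i in [set: nat]) (if (i < N)%N then 0 else (w i)%:E) < e%:E)%E.
Proof.
move=> w0 woo e0; have w0' i : (0 <= (w i)%:E)%E by rewrite lee_fin.
have [A hA] := esum_tail w0' woo e0; pose N := (\max_(i <- A) i.+1)%N; exists N.
have := hA [fset i in iota 0 N]%fset; rewrite (_ : (A `<=` _)%fset).
  move=> /(_ isT); apply: le_lt_trans; apply: le_esum => i _.
  by rewrite !inE mem_iota add0n.
apply/fsubsetP => i iA; rewrite !inE mem_iota add0n /=.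
exact: (@leq_bigmax_seq _ _ xpredT (fun i : nat => i.+1)).
Qed.

(** The solution is the sum of the iterates Q^n x, which converges because [X] is complete; the
    partial sums telescope under 1 - Q. *)
Lemma neumann_series (Q : X -> X) (x : X) : linear_map Q ->
  (forall v, nrm (Q v) <= 2^-1 * nrm v) -> exists u, u - Q u = x.
Proof.
move=> lQ Qhalf; pose u_ n := iter n Q x.
have uB n : nrm (u_ n) <= 2^-1 ^+ n * nrm x.
  elim: n => [|n IH]; first by rewrite mul1r.
  by rewrite exprS -mulrA (le_trans (Qhalf _))// ler_wpM2l// invr_ge0.
have tailB m k : nrm (\sum_(i < k) u_ (m + i)%N) <= 2 * (2^-1 ^+ m * nrm x).
  (* The exact geometric sum is what the induction on [k] preserves. *)
  suff : nrm (\sum_(i < k) u_ (m + i)%N) <= (2 - 2 * 2^-1 ^+ k) * (2^-1 ^+ m * nrm x).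
    move=> /le_trans; apply; rewrite ler_wpM2r ?mulr_ge0 ?nrm_ge0 ?exprn_ge0 ?invr_ge0//.
    by have : 0 <= (2^-1 : R) ^+ k; [rewrite exprn_ge0 ?invr_ge0|lra].
  elim: k => [|k IH]; first by rewrite big_ord0 nrm0 expr0 mulr1 subrr mul0r.
  rewrite big_ord_recr/=; apply: le_trans (nrmD _ _) _.
  have := uB (m + k)%N; rewrite exprD exprS.
  move: IH; set S := nrm _; set P := nrm _; set a := 2^-1 ^+ k; set b := 2^-1 ^+ m.
  by move=> IH h; rewrite mulrA divff// mul1r; nra.
have cvs : cvgn (series u_).
  apply: cauchy_cvg; apply/cauchy_seriesP => e e0.
  have [re0 eE] : 0 < complex.Re e /\ e = (complex.Re e)%:C.
    by case: e e0 => re im; rewrite ltcE /= => /andP[/eqP -> ?].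
  have [N hN] := exists_halving (2 * nrm x) re0.
  exists ([set n | (N <= n)%N], setT); first by split; [exists N|exists 0%N].
  move=> [n1 n2] [/= Nn1 _]; rewrite eE normE_nrm ltcR; apply: le_lt_trans hN.
  have -> : \sum_(n1 <= k < n2) u_ k = \sum_(i < n2 - n1) u_ (n1 + i)%N.
    have [h|h] := leqP n1 n2; last first.
      by rewrite big_geq ?(ltnW h)// (eqP (ltnW h)) big_ord0.
    by rewrite -{1}(add0n n1) big_addn big_mkord; apply: eq_bigr => i _; rewrite addnC.
  apply: le_trans (tailB _ _) _; rewrite mulrCA ler_wpM2r ?mulr_ge0 ?nrm_ge0//.
  by apply: ler_wiXn2l => //; lra.
pose u : X := limn (series u_).
have /cvg_nrmP su : series u_ @ \oo --> u by exact: cvs.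
exists u; apply/eqP; rewrite -subr_eq0; apply/eqP/nrm0_eq0/ler_addgt0Pr => e e0.
rewrite add0r.
have [|N1 h1] := su (e / 4); first by rewrite divr_gt0.
have [|N2 h2] := @exists_halving _ (nrm x) (e / 4); first by rewrite divr_gt0.
pose n := maxn N1 N2.
have QD v w : Q (v + w) = Q v + Q w by rewrite -{1}(scale1r v) lQ scale1r.
have QB v w : Q (v - w) = Q v - Q w.
  by rewrite -scaleN1r addrC lQ scaleN1r addrC.
have tele k : series u_ k - Q (series u_ k) = x - u_ k.
  rewrite /series/=; elim: k => [|k IH]; first by rewrite !big_geq// linear_map0// !subrr.
  by rewrite big_nat_recr//= QD opprD addrACA IH addrA subrK.
set s := series u_ n.
have -> : u - Q u - x = (u - s) - Q (u - s) - u_ n.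
  have -> : u_ n = x - (s - Q s) by rewrite /s tele subKr.
  by rewrite QB (opprD (Q u)) (addrACA u) -opprD (opprB x) addrA subrK.
have := h1 n (leq_maxl _ _); rewrite -/s.
have : nrm (u_ n) <= 2^-1 ^+ N2 * nrm x.
  apply: le_trans (uB n) _; rewrite ler_wpM2r ?nrm_ge0//.
  by apply: ler_wiXn2l; rewrite ?leq_maxr//; lra.
have := Qhalf (u - s); have := nrmB (u - s) (Q (u - s)).
have := nrmB (u - s - Q (u - s)) (u_ n); lra.
Qed.

(** Truncating the representation where the tail of the weights is below 1/2 gives a finite-rank [F]
    with |v - F v| <= |v| / 2. By the Neumann series for 1 - F, the map [F] is onto, so the first
    [N] vectors [y i] span [X]. *)
Lemma nuclear_id_finite_dim (a : nat -> X -> R[i]) (y : nat -> X) (w : nat -> R)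
    (s : R) : nuclear_data (fun x => x) a y w s -> finite_dim X.
Proof.
move=> dI; have w0 := nuclear_data_ge0 dI; case: (dI) => la _ ws cI.
have [|N hN] := @esum_nat_tail w 2^-1 w0 (le_lt_trans ws (ltry _)).
  by rewrite invr_gt0.
pose F x := \sum_(i < N) a i x *: y i.
have lF : linear_map F.
  move=> c u v; rewrite /F scaler_sumr -big_split/=; apply: eq_bigr => i _.
  by rewrite la scalerDl scalerA.
have Qhalf v : nrm (v - F v) <= 2^-1 * nrm v.
  pose t i := if (i < N)%N then 0 else a i v *: y i.
  have ct : (fun n : nat => \sum_(i < n) t i) @ \oo --> v - F v.
    have /cvg_nrmP cv := cI v; apply/cvg_nrmP => e e0; have [N1 hN1] := cv e e0.
    exists (maxn N1 N) => n; rewrite geq_max => /andP[N1n Nn].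
    have := hN1 n N1n; rewrite -(subnKC Nn) !big_split_ord/= -/(F v).
    rewrite [X in _ -> nrm (_ - (X + _)) < _]big1 => [|i _]; last by rewrite /t ltn_ord.
    rewrite add0r (eq_bigr (fun i : 'I_(n - N) => t (N + i)%N)) => [|i _].
      by rewrite opprD addrA.
    by rewrite /t ltnNge leq_addr.
  pose f i := nrm v * (if (i < N)%N then 0 else w i).
  have tf i : nrm (t i) <= f i.
    rewrite /t /f; case: ifP => _; first by rewrite nrm0 mulr0.
    by rewrite mulrC (nuclear_data_term dI).
  have := cvg_series_le ct tf; rewrite -lee_fin => /le_trans; apply.
  under eq_esum do rewrite EFinM.
  rewrite esumZl ?lee_fin ?nrm_ge0//; last by move=> i; case: ifP; rewrite lee_fin.
  rewrite mulrC EFinM lee_wpmul2l ?lee_fin ?nrm_ge0//; apply: ltW.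
  by apply: le_lt_trans hN; apply: le_esum => i _; case: ifP.
have lQ : linear_map (fun v => v - F v).
  by move=> c u v; rewrite lF opprD addrACA scalerBr.
exists N, (fun i : 'I_N => y i) => x.
have [u] := neumann_series x lQ Qhalf; rewrite subKr => <-.
by exists (fun i : 'I_N => a i u).
Qed.

End NuclearIdentity.

(** * Operators on l_p *)

Section LpFamilies.
Context {R : realType} {X : completeNormedModType R[i]} {c : nat} (p : \bar R).
Hypothesis p1 : (1 <= p)%E.
Implicit Types x y z : Zc c -> X.

Lemma lp_normE x : lp_norm p x = lpR p (fun k => nrm (x k)).
Proof. by []. Qed.

(** Minkowski's inequality over the index set [bool]. *)
Lemma lpRD (u v : Zc c -> R) : (forall k, 0 <= u k) -> (forall k, 0 <= v k) ->
  (lpR p (fun k => u k + v k)%R <= lpR p u + lpR p v)%E.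
Proof.
move=> u0 v0.
have esum_bool (f : bool -> \bar R) : (forall b, 0 <= f b)%E ->
    (\esum_(b in [set: bool]) f b = f true + f false)%E.
  move=> f0; rewrite (esumID [set true])// setTI esum_set1//; congr (_ + _)%E.
  rewrite (_ : _ `&` _ = [set false]) ?esum_set1//.
  by apply/seteqP; split => -[] //= [].
have := @lpR_minkowski _ _ bool p (fun k => u k + v k) (fun b => if b then u else v) p1.
rewrite esum_bool; last by case; apply: lpR_ge0.
apply; [by move=> k; rewrite addr_ge0|by case|].
by move=> k; rewrite esum_bool ?EFinD// => -[]; rewrite lee_fin.
Qed.

Lemma lp_mem_le x y : (forall k, nrm (x k) <= nrm (y k)) -> lp_mem p y -> lp_mem p x.
Proof.
move=> xy; rewrite /lp_mem !lp_normE; apply: le_lt_trans; apply: le_lpR => // k.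
by rewrite nrm_ge0 xy.
Qed.

Lemma lp_mem_lin (a : R[i]) x y : lp_mem p x -> lp_mem p y ->
  lp_mem p (fun k => a *: x k + y k).
Proof.
move=> xp yp.
have ax0 k : 0 <= cabs a * nrm (x k) by rewrite mulr_ge0 ?cabs_ge0 ?nrm_ge0.
have y0 k : 0 <= nrm (y k) by exact: nrm_ge0.
apply: (@le_lt_trans _ _ (lpR p (fun k => cabs a * nrm (x k) + nrm (y k)))).
  apply: (@le_lpR _ _ p (fun k => nrm (a *: x k + y k))) => // k.
  by rewrite nrm_ge0 (le_trans (nrmD _ _))// nrmZ.
apply: le_lt_trans (lpRD ax0 y0) _; apply: lte_add_pinfty => //.
rewrite lpRZ ?cabs_ge0//; last by move=> k; apply: nrm_ge0.
by apply: lte_mul_pinfty; rewrite ?lee_fin ?cabs_ge0.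
Qed.

Lemma lp_mem0 : lp_mem p (fun _ : Zc c => 0 : X).
Proof.
apply: (@le_lt_trans _ _ 0%:E); last exact: ltry.
apply: le_trans (lpR_delta 0 p1 (lexx 0)).
by apply: (@le_lpR _ _ p (fun=> nrm 0)) => // k; rewrite nrm0 if_same lexx.
Qed.

Definition single (l : Zc c) (v : X) : Zc c -> X := fun k => if k == l then v else 0.

Lemma lp_mem_single l v : lp_mem p (single l v).
Proof.
apply: (@le_lt_trans _ _ (nrm v)%:E); last exact: ltry.
apply: le_trans (lpR_delta l p1 (nrm_ge0 v)).
apply: (@le_lpR _ _ p (fun k => nrm (single l v k))) => // k; rewrite nrm_ge0 /single.
by case: (k == l); rewrite ?nrm0 lexx.
Qed.

Lemma single_lin l (a : R[i]) u v :
  single l (a *: u + v) = (fun k => a *: single l u k + single l v k).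
Proof. by apply/funext => k; rewrite /single; case: ifP; rewrite ?scaler0 ?addr0. Qed.

Lemma lp_mem_sum (I : Type) (s : seq I) (z : I -> Zc c -> X) :
  (forall i, lp_mem p (z i)) -> lp_mem p (fun k => \sum_(i <- s) z i k).
Proof.
move=> zp; elim: s => [|i s IH].
  by under eq_fun do rewrite big_nil; exact: lp_mem0.
have := lp_mem_lin 1 (zp i) IH.
by under [X in _ -> lp_mem _ X]eq_fun do rewrite big_cons -(scale1r (z i _)).
Qed.

Context (Q : (Zc c -> X) -> (Zc c -> X)).
Hypothesis bQ : bounded_op p Q.

Lemma bounded_op0 : Q (fun=> 0) = fun=> 0.
Proof.
case: bQ => _ lQ _; have := lQ (-1) _ _ lp_mem0 lp_mem0.
rewrite (_ : (fun k : Zc c => -1 *: 0 + 0) = fun=> 0 : X) => [->|]; last first.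
  by apply/funext => k; rewrite scaler0 addr0.
by apply/funext => k; rewrite scaleN1r addNr.
Qed.

Lemma bounded_op_sum (I : Type) (s : seq I) (z : I -> Zc c -> X) :
  (forall i, lp_mem p (z i)) ->
  Q (fun k => \sum_(i <- s) z i k) = fun k => \sum_(i <- s) Q (z i) k.
Proof.
move=> zp; case: (bQ) => _ lQ _; elim: s => [|i s IH].
  have -> : (fun k => \sum_(i <- [::]) z i k) = fun=> 0 by apply/funext => k; rewrite big_nil.
  by rewrite bounded_op0; apply/funext => k; rewrite big_nil.
have -> : (fun k => \sum_(j <- i :: s) z j k) =
    (fun k => 1 *: z i k + \sum_(j <- s) z j k).
  by apply/funext => k; rewrite big_cons scale1r.
rewrite lQ//; last exact: lp_mem_sum.
by rewrite IH; apply/funext => k; rewrite big_cons scale1r.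
Qed.

(** Asked of all families in l_p rather than of matrix entries: for [p = +oo] finitely supported
    families are in general not dense, so bounds on entries would not control [Q]. *)
Definition dominated (gamma : Zc c -> R) : Prop :=
  forall x, lp_mem p x -> forall k, ((nrm (Q x k))%:E <=
    convol (fun m => (gamma m)%:E) (fun l => (nrm (x l))%:E) k)%E.

Context (gamma : Zc c -> R).
Hypotheses (gamma0 : forall m, 0 <= gamma m)
  (gammaoo : (\esum_(m in [set: Zc c]) (gamma m)%:E < +oo)%E)
  (dQ : dominated gamma).

(** Indexed by row and offset, like the coefficient b_(km) of a locally nuclear operator; the column
    is k - m. *)
Definition entry (k m : Zc c) (v : X) : X := Q (single (k - m) v) k.

Lemma entry_linear k m : linear_map (entry k m).
Proof.
by move=> a u v; case: bQ => _ lQ _; rewrite /entry single_lin lQ//; apply: lp_mem_single.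
Qed.

Lemma entry_bound k m v : nrm (entry k m v) <= gamma m * nrm v.
Proof.
rewrite -lee_fin; apply: le_trans (dQ (lp_mem_single _ _) _) _; rewrite /convol.
rewrite -(@esum_set1 _ _ m (fun=> (gamma m * nrm v)%:E)) ?lee_fin ?mulr_ge0 ?nrm_ge0//.
rewrite [leRHS]esum_mkcond; apply: le_esum => j _; rewrite in_set1 /single.
by rewrite (inj_eq (addrI k)) (inj_eq oppr_inj); case: eqP => [->//|_]; rewrite nrm0 mule0.
Qed.

Lemma convol_finite x k : lp_mem p x ->
  (convol (fun m => (gamma m)%:E) (fun l => (nrm (x l))%:E) k < +oo)%E.
Proof.
move=> xp; have x0 l : 0 <= nrm (x l) by exact: nrm_ge0.
have L0 : (0 <= lpR p (fun l => nrm (x l)))%E by apply: lpR_ge0.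
apply: (@le_lt_trans _ _ (convol (fun m => (gamma m)%:E) (fun=> lpR p (fun l => nrm (x l))) k)).
  apply: le_convol => m; rewrite ?lee_fin//.
  exact: (lpR_term (u := fun l => nrm (x l))).
rewrite convol_cst//; apply: lte_mul_pinfty => //.
by rewrite ge0_fin_numE.
Qed.

(** By linearity the error over [B] is the value at [k] of [Q] on [x] with the positions k - m, m in
    [B], set to 0. Domination bounds it by a tail of a finite convolution sum. *)
Lemma entry_sum x k : lp_mem p x ->
  unord_sum_to (fun m => entry k m (x (k - m))) (Q x k).
Proof.
move=> xp e e0; have x0 l : (0 <= (nrm (x l))%:E)%E by rewrite lee_fin nrm_ge0.
have a0 m : (0 <= (gamma m)%:E * (nrm (x (k - m)))%:E)%E.
  by rewrite mule_ge0// lee_fin.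
have [A hA] := esum_tail a0 (convol_finite k xp) e0.
exists A => B AB; rewrite -lte_fin; apply: le_lt_trans (hA B AB).
pose z m := single (k - m) (x (k - m)).
have zp m : lp_mem p (z m) by exact: lp_mem_single.
have zsp := lp_mem_sum (enum_fset B) zp.
have -> : Q x k - \sum_(i <- B) entry k i (x (k - i)) =
    Q (fun l => -1 *: (\sum_(m <- B) z m l) + x l) k.
  by case: (bQ) => _ -> // _; rewrite bounded_op_sum// scaleN1r addrC.
apply: le_trans (dQ _ _) _; first exact: lp_mem_lin.
apply: le_esum => m _.
have zE : \sum_(j <- B) z j (k - m) = if m \in B then x (k - m) else 0.
  have E j : z j (k - m) = if j == m then x (k - m) else 0.
    rewrite /z /single (inj_eq (addrI k)) (inj_eq oppr_inj) eq_sym.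
    by case: eqP => [->|].
  under eq_bigr do rewrite E.
  case: ifP => mB.
    rewrite (big_fsetD1 _ mB)/= eqxx big_seq big1 ?addr0// => j.
    by rewrite !inE => /andP[/negPf ->].
  rewrite big_seq big1// => j jB; case: eqP => // jm.
  by move: jB; rewrite jm mB.
rewrite zE scaleN1r; case: ifP => _; first by rewrite addNr nrm0 mule0.
by rewrite oppr0 add0r.
Qed.

End LpFamilies.

(** * Off-diagonal decay of the inverse *)

Section Localisation.
Context {R : realType} {X : completeNormedModType R[i]} {c : nat}.
Context (p : \bar R) (g : Zc c -> R).
Hypotheses (p1 : (1 <= p)%E) (wg : is_weight g).

Let g1 m : 1 <= g m. Proof. by case: wg. Qed.
Let g0 m : 0 <= g m. Proof. exact: le_trans (g1 m). Qed.

(** Outside a finite set [A] the mass of [beta] is below e/2; on [A] the factor 1 - window is at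
    most |m| (1 - q), which is small for q near 1. *)
Lemma window_small (beta : Zc c -> R) (e : R) : (forall m, 0 <= beta m) ->
  (\esum_(m in [set: Zc c]) (g m * beta m)%:E < +oo)%E -> 0 < e ->
  exists2 r, 0 < r < 1 &
    (\esum_(m in [set: Zc c]) (g m * (beta m * (1 - window (r ^+ 2) m)))%:E <= e%:E)%E.
Proof.
move=> b0 boo e0.
have a0 m : (0 <= (g m * beta m)%:E)%E by rewrite lee_fin mulr_ge0.
have e20 : 0 < e / 2 by rewrite divr_gt0.
have [A /(_ A (fsubset_refl A)) hA] := esum_tail a0 boo e20.
pose S := \sum_(m <- A) g m * beta m * (l1len m)%:R.
have S0 : 0 <= S by apply: sumr_ge0 => m _; rewrite !mulr_ge0.
(* Chosen so that 1 - q <= 2t and 2tS <= e/2; the 1 added to [S] keeps the denominator positive. *)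
pose t := Num.min 2^-1 (e / (4 * (S + 1))).
have t0 : 0 < t by rewrite lt_min invr_gt0 ltr0n divr_gt0//; lra.
have t2 : t <= 2^-1 by rewrite ge_min lexx.
have tS : t * (4 * (S + 1)) <= e.
  by rewrite -ler_pdivlMr ?ge_min ?lexx ?orbT//; lra.
exists (1 - t); first by apply/andP; split; lra.
set q := (1 - t) ^+ 2.
have q01 : 0 <= q <= 1 by rewrite /q expr2; apply/andP; split; nra.
have qt : 1 - q <= 2 * t by rewrite /q expr2; nra.
have k0 m : 0 <= 1 - window q m by rewrite subr_ge0 window_le1.
have k1 m : 1 - window q m <= 1.
  by rewrite gerBl window_ge0//; case/andP: q01.
apply: (@le_trans _ _ (\esum_(m in [set: Zc c])
   ((if m \in A then (2 * t * (g m * beta m * (l1len m)%:R))%:E else 0) +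
    (if m \in A then 0 else (g m * beta m)%:E)))%E).
  apply: le_esum => m _; rewrite mulrA; case: ifP => _.
    rewrite adde0 lee_fin mulrCA ler_wpM2l ?mulr_ge0//.
    rewrite mulrC; apply: le_trans (one_sub_window m q01) _.
    by rewrite ler_wpM2l.
  by rewrite add0e lee_fin ler_piMr// mulr_ge0.
rewrite esumD; last 2 first.
- by move=> m _; case: ifP => // _; rewrite lee_fin !mulr_ge0// ltW.
- by move=> m _; case: ifP.
rewrite [e in leRHS](splitr e) EFinD; apply: leeD; last exact: ltW.
have -> : (\esum_(m in [set: Zc c])
    (if m \in A then (2 * t * (g m * beta m * (l1len m)%:R))%:E else 0) = (2 * t * S)%:E)%E.
  rewrite (eq_esum (b := fun m => (if m \in [set` A] then
    (2 * t * (g m * beta m * (l1len m)%:R))%:E else 0)%E)); last first.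
    by move=> m _; congr (if _ then _ else _); rewrite mem_setE.
  rewrite -esum_mkcond esum_fset//; last first.
    by move=> m _; rewrite lee_fin !mulr_ge0// ltW.
  by rewrite fsbig_finite//= set_fsetK sumEFin mulr_sumr.
by rewrite lee_fin; nra.
Qed.

Context (T B : (Zc c -> X) -> (Zc c -> X)) (lam : R[i]) (beta : Zc c -> R)
  (b : Zc c -> Zc c -> X -> X).
Hypotheses (b0 : forall m, 0 <= beta m)
  (boo : (\esum_(m in [set: Zc c]) (g m * beta m)%:E < +oo)%E)
  (blin : forall k m, linear_map (b k m))
  (bbound : forall k m v, nrm (b k m v) <= beta m * nrm v)
  (Tsum : forall x, lp_mem p x -> forall k,
     unord_sum_to (fun m => b k m (x (k - m))) (T x k)).

Let A x : Zc c -> X := fun k => lam *: x k + T x k.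

Hypothesis AB : inverse_in_B p A B.

Let kap q (m : Zc c) : R := 1 - window q m.

(** The local norm alpha_k of the opening comment. *)
Definition win_norm q (x : Zc c -> X) k : \bar R :=
  lpR p (fun i => window q (i - k) * nrm (x i)).

Definition windowed q (k : Zc c) (x : Zc c -> X) : Zc c -> X :=
  fun i => (window q (i - k))%:C *: x i.

(** Coordinate i of the commutator is the sum over m of (phi_k (i - m) - phi_k (i)) b_(im) x_(i -
    m). Each difference is bounded by [window_diff], and Minkowski's inequality sums over m. *)
Lemma commutator_bound q x (k : Zc c) : 0 <= q <= 1 -> lp_mem p x ->
  (lpR p (fun i => nrm (T (windowed q k x) i - windowed q k (T x) i)%R) <=
   \esum_(m in [set: Zc c]) ((beta m * kap q m)%:E *
     (win_norm q x k + win_norm q x (k - m)%R)))%E.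
Proof.
move=> /[dup] q01 /andP[q0 q1] xp.
have w0 (m : Zc c) : 0 <= window q m by exact: window_ge0.
have kp0 m : 0 <= kap q m by rewrite subr_ge0 window_le1.
have bk0 m : 0 <= beta m * kap q m by rewrite mulr_ge0.
pose xk := windowed q k x.
have nxk i : nrm (xk i) = window q (i - k) * nrm (x i).
  by rewrite /xk /windowed nrmZ cabs_real ger0_norm.
have xkp : lp_mem p xk.
  apply: lp_mem_le xp => // i; rewrite nxk ler_piMl ?nrm_ge0//.
  exact: window_le1.
pose v m i := beta m * kap q m *
  ((window q (i - m - k) + window q (i - k)) * nrm (x (i - m))).
have v0 m i : 0 <= v m i by rewrite /v !mulr_ge0// ?addr_ge0 ?nrm_ge0.
apply: (@le_trans _ _ (\esum_(m in [set: Zc c]) lpR p (v m))).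
  apply: lpR_minkowski => // [i|i]; first exact: nrm_ge0.
  rewrite {2}/windowed addrC -scaleNr.
  have := unord_sum_lin (- (window q (i - k))%:C) (Tsum xp i) (Tsum xkp i).
  move=> /unord_sum_le; apply => m.
  have bZ (a : R[i]) u : b i m (a *: u) = a *: b i m u.
    by have := blin i m a u 0; rewrite (linear_map0 (blin i m)) !addr0.
  rewrite /xk /windowed bZ -scalerDl -rmorphN -rmorphD nrmZ cabs_real /v.
  rewrite addrC.
  have := window_diff (i - m - k) (i - k) q01.
  rewrite (_ : i - m - k - (i - k) = - m); last first.
    by rewrite opprB addrA subrK addrAC subrr add0r.
  rewrite windowN -/(kap q m) => h.
  rewrite [leRHS](_ : _ = (kap q m * (window q (i - m - k) + window q (i - k))) *
    (beta m * nrm (x (i - m)))); last by ring.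
  by apply: ler_pM => //; exact: nrm_ge0.
apply: le_esum => m _.
pose u1 j := window q (j - k) * nrm (x j).
pose u2 j := window q (j - (k - m)) * nrm (x j).
have u10 j : 0 <= u1 j by rewrite mulr_ge0 ?nrm_ge0.
have u20 j : 0 <= u2 j by rewrite mulr_ge0 ?nrm_ge0.
(* Here phi_k (i) = phi_(k - m) (i - m) makes both terms translates by m. *)
have -> : v m = fun i => beta m * kap q m * (u1 (i - m) + u2 (i - m)).
  apply/funext => i; rewrite /v /u1 /u2 -mulrDl; congr (_ * ((_ + window q _) * _)).
  by rewrite opprB addrA subrK.
rewrite lpRZ//; last by move=> i; rewrite addr_ge0.
apply: lee_wpmul2l; first by rewrite lee_fin.
by rewrite (lpR_shift p (fun i => u1 i + u2 i)); apply: lpRD.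
Qed.

Lemma inverse_dominated : exists gamma : Zc c -> R,
  [/\ forall m, 0 <= gamma m,
      (\esum_(m in [set: Zc c]) (g m * gamma m)%:E < +oo)%E &
      dominated p B gamma].
Proof.
case: (AB) => bA bB invAB; case: (bB) => Bmem _ [M0 BM0].
pose M := Num.max M0 0.
have M_ge0 : 0 <= M by rewrite le_max lexx orbT.
have BM x : lp_mem p x -> (lp_norm p (B x) <= M%:E * lp_norm p x)%E.
  move=> xp; apply: le_trans (BM0 x xp) _; apply: lee_wpmul2r.
    by rewrite lp_normE lpR_ge0// => k; apply: nrm_ge0.
  by rewrite lee_fin le_max lexx.
(* With M e <= 1/4 the diagonal term M s alpha_k can be absorbed on the left, at the price of a
   factor 2, and the kernel [V] has weighted mass at most 2 M e <= 1/2. *)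
pose e := (4 * (M + 1))^-1.
have e0 : 0 < e by rewrite invr_gt0 mulr_gt0//; lra.
have Me : M * e <= 4^-1.
  by rewrite /e invfM mulrCA ler_piMr ?invr_ge0// ler_pdivrMr; lra.
have [r r01 hr] := window_small b0 boo e0.
set q := r ^+ 2 in hr.
have q01 : 0 <= q <= 1 by case/andP: r01 => r0 r1; rewrite /q expr2; apply/andP; split; nra.
have /andP[q0 q1] := q01.
have w0 (m : Zc c) : 0 <= window q m :> R by exact: window_ge0.
have kp0 m : 0 <= kap q m by rewrite subr_ge0 window_le1.
have bk0 m : 0 <= beta m * kap q m by rewrite mulr_ge0.
pose V (m : Zc c) : \bar R := (2 * M * (beta m * kap q m))%:E.
pose F (m : Zc c) : \bar R := (2 * M * window q m)%:E.
have M20 : 0 <= 2 * M by rewrite mulr_ge0.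
have V0 m : (0 <= V m)%E by rewrite lee_fin mulr_ge0.
have F0 m : (0 <= F m)%E by rewrite lee_fin mulr_ge0.
have wV : (\esum_(m in [set: Zc c]) ((g m)%:E * V m) <= (2^-1)%:E)%E.
  rewrite (eq_esum (b := fun m => ((2 * M)%:E * (g m * (beta m * kap q m))%:E)%E)); last first.
    by move=> m _; rewrite /V -!EFinM mulrCA.
  rewrite esumZl ?lee_fin//; last by move=> m; rewrite lee_fin mulr_ge0.
  apply: le_trans (lee_wpmul2l _ hr) _; rewrite ?lee_fin//; lra.
have wF : (\esum_(m in [set: Zc c]) ((g m)%:E * F m) < +oo)%E.
  rewrite (eq_esum (b := fun m => ((2 * M)%:E * (g m * window q m)%:E)%E)); last first.
    by move=> m _; rewrite /F -!EFinM mulrCA.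
  rewrite esumZl ?lee_fin//; last by move=> m; rewrite lee_fin mulr_ge0.
  by apply: lte_mul_pinfty; rewrite ?lee_fin//; apply: esum_weight_window.
have gM m n : g (m + n) <= g m * g n by case: wg.
have [gamma [gam0 gamoo hgam]] := conv_inequality g1 gM V0 F0 wV wF.
exists gamma; split => // y yp k.
pose x := B y; have xp : lp_mem p x by exact: Bmem.
have Ax : A x = y by have [] := invAB y yp.
have nx0 i : 0 <= nrm (x i) by exact: nrm_ge0.
have ny0 i : 0 <= nrm (y i) by exact: nrm_ge0.
have wn0 j : (0 <= win_norm q x j)%E.
  by apply: lpR_ge0 => // i; rewrite mulr_ge0.
have Lfin : lpR p (fun i => nrm (x i)) \is a fin_num.
  by rewrite ge0_fin_numE ?lpR_ge0.
have wnL j : (win_norm q x j <= (fine (lpR p (fun i => nrm (x i))))%:E)%E.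
  rewrite fineK//; apply: le_lpR => // i.
  by rewrite mulr_ge0//= ler_piMl// window_le1.
apply: (@le_trans _ _ (win_norm q x k)).
  have := @lpR_term _ _ p (fun i => window q (i - k) * nrm (x i)) k p1.
  rewrite subrr window0 mul1r; apply.
  by move=> i; rewrite mulr_ge0.
apply: (hgam (fine (lpR p (fun i => nrm (x i)))) (win_norm q x)) => //.
  by rewrite fine_ge0// lpR_ge0.
move=> {}k.
(* Minkowski's inequality for the decomposition of [y] into its one-point pieces. *)
have eta_le : (win_norm q y k <= convol (fun m => (window q m)%:E) (fun l => (nrm (y l))%:E) k)%E.
  rewrite /convol -(esum_subr _ k).
  apply: (@le_trans _ _ (\esum_(l in [set: Zc c])
     lpR p (fun i => if i == l then window q (l - k) * nrm (y l) else 0)%R)).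
    apply: lpR_minkowski => // [i|l i|i].
    - by rewrite mulr_ge0.
    - by case: ifP => // _; rewrite mulr_ge0.
    have := @esum_term _ _ (fun l => (if i == l then window q (l - k) * nrm (y l) else 0)%R%:E) i.
    rewrite eqxx; apply => l; case: ifP => // _.
    by rewrite lee_fin mulr_ge0.
  apply: le_esum => l _; apply: le_trans (lpR_delta _ _ _) _ => //; first by rewrite mulr_ge0.
  by rewrite subKr -(opprB l k) windowN EFinM.
pose xk := windowed q k x.
have nxk i : nrm (xk i) = window q (i - k) * nrm (x i).
  by rewrite /xk /windowed nrmZ cabs_real ger0_norm.
have xkp : lp_mem p xk.
  apply: lp_mem_le xp => // i; rewrite nxk ler_piMl//.
  exact: window_le1.
have Axkp : lp_mem p (A xk) by case: bA => + _ _; apply.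
pose D i := T xk i - windowed q k (T x) i.
(* Apply B A = 1 to phi_k x and use A (phi_k x) = phi_k y + D, with [D] the commutator term. *)
have step1 : (win_norm q x k <= M%:E * (win_norm q y k + lpR p (fun i => nrm (D i))))%E.
  have := BM _ Axkp; have [_ ->] := invAB _ xkp; rewrite !lp_normE.
  under [X in (lpR p X <= _)%E -> _]eq_fun do rewrite nxk.
  move=> /le_trans; apply; apply: lee_wpmul2l; first by rewrite lee_fin.
  apply: le_trans (lpRD _ _ _) => //; last 2 first.
  - by move=> i; rewrite mulr_ge0.
  - by move=> i; exact: nrm_ge0.
  apply: le_lpR => // i; rewrite nrm_ge0/=.
  have -> : A xk i = (window q (i - k))%:C *: y i + D i.
    rewrite -Ax /A /D scalerDr /xk /windowed !scalerA (mulrC lam) -addrA; congr (_ + _).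
    by rewrite addrC subrK.
  by apply: le_trans (nrmD _ _) _; rewrite nrmZ cabs_real ger0_norm.
have step2 := commutator_bound k q01 xp.
pose s := (\esum_(m in [set: Zc c]) (beta m * kap q m)%:E)%E.
have s0 : (0 <= s)%E by apply: esum_ge0 => m _; rewrite lee_fin.
have se : (s <= e%:E)%E.
  apply: le_trans hr; apply: le_esum => m _; rewrite lee_fin.
  by rewrite -{1}(mul1r (beta m * _)) ler_wpM2r.
pose W := convol (fun m => (beta m * kap q m)%:E) (win_norm q x) k.
have W0 : (0 <= W)%E by apply: convol_ge0 => // m; rewrite lee_fin.
have step3 : (win_norm q x k <= M%:E * (win_norm q y k + (s * win_norm q x k + W)))%E.
  apply: le_trans step1 _; apply: lee_wpmul2l; first by rewrite lee_fin.
  apply: leeD2l; apply: le_trans step2 _.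
  rewrite (eq_esum (b := fun m => (win_norm q x k * (beta m * kap q m)%:E +
     (beta m * kap q m)%:E * win_norm q x (k - m)%R)%E)); last first.
    by move=> m _; rewrite ge0_muleDr// (muleC (win_norm q x k)).
  rewrite esumD; last 2 first.
  - by move=> m _; rewrite mule_ge0// lee_fin.
  - by move=> m _; rewrite mule_ge0// lee_fin.
  by rewrite esumZl// ?(muleC s)// => m; rewrite lee_fin.
have -> : convol V (win_norm q x) k = ((2 * M)%:E * W)%E.
  rewrite /W /convol -esumZl ?lee_fin//; last by move=> m; rewrite mule_ge0// lee_fin.
  by apply: eq_esum => m _; rewrite /V EFinM muleA.
have -> : convol F (fun l => (nrm (y l))%:E) k =
    ((2 * M)%:E * convol (fun m => (window q m)%:E) (fun l => (nrm (y l))%:E) k)%E.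
  rewrite /convol -esumZl ?lee_fin//; last by move=> m; rewrite mule_ge0// lee_fin.
  by apply: eq_esum => m _; rewrite /F EFinM muleA.
rewrite -ge0_muleDr//; last by apply: convol_ge0 => m; rewrite lee_fin.
apply: (@le_trans _ _ ((2 * M)%:E * (win_norm q y k + W))%E); last first.
  by apply: lee_wpmul2l; rewrite ?lee_fin// leeD2r.
(* All quantities are shown finite, so that the absorption can be done by real arithmetic. *)
have xfin j : win_norm q x j \is a fin_num.
  by rewrite ge0_fin_numE//; apply: le_lt_trans (wnL j) (ltry _).
have wy0 : (0 <= win_norm q y k)%E by apply: lpR_ge0 => // i; rewrite mulr_ge0.
have yfin : win_norm q y k \is a fin_num.
  rewrite ge0_fin_numE//; apply: le_lt_trans yp; rewrite lp_normE; apply: le_lpR => // i.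
  by rewrite mulr_ge0//= ler_piMl// window_le1.
have sfin : s \is a fin_num by rewrite ge0_fin_numE//; apply: le_lt_trans se (ltry _).
have Wfin : W \is a fin_num.
  rewrite ge0_fin_numE//; apply: (@le_lt_trans _ _ (convol (fun m => (beta m * kap q m)%:E)
    (fun=> (fine (lpR p (fun i => nrm (x i))))%:E) k)).
    by apply: le_convol => m; rewrite ?lee_fin.
  rewrite convol_cst ?lee_fin ?fine_ge0 ?lpR_ge0//.
  by rewrite -/s -(fineK sfin) -EFinM ltry.
move: step3 wn0 wy0 s0 se W0 => /[swap] /(_ k).
rewrite -(fineK (xfin k)) -(fineK yfin) -(fineK sfin) -(fineK Wfin).
rewrite -!(EFinM, EFinD) !lee_fin.
move: (fine (win_norm q x k)) (fine (win_norm q y k)) (fine s) (fine W) => X' Y S' W'.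
move=> X0 h Y0 S0 Se W'0.
have : M * S' * X' <= 4^-1 * X'.
  by rewrite ler_wpM2r// (le_trans _ Me)// ler_wpM2l.
by nra.
Qed.

End Localisation.

(** * Nuclearity of the inverse *)

Section InverseNuclear.
Context {R : realType} {X : completeNormedModType R[i]} {c : nat}.
Context (p : \bar R) (g : Zc c -> R).
Hypotheses (p1 : (1 <= p)%E) (wg : is_weight g).

Let g1 m : 1 <= g m. Proof. by case: wg. Qed.
Let g0 m : 0 <= g m. Proof. exact: le_trans (g1 m). Qed.
Let gM m n : g (m + n) <= g m * g n. Proof. by case: wg. Qed.

Lemma l1gE (beta : Zc c -> R) : (forall m, 0 <= beta m) ->
  l1g g beta <-> (\esum_(m in [set: Zc c]) (g m * beta m)%:E < +oo)%E.
Proof.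
by move=> b0; rewrite /l1g; under eq_esum do rewrite ger0_norm//.
Qed.

(* The infimum in the nuclear norm need not be attained, so the majorant is
   enlarged by a positive summable family. *)
Lemma locally_nuclear_data (T : (Zc c -> X) -> (Zc c -> X)) :
  locally_nuclear p g T ->
  exists (b : Zc c -> Zc c -> X -> X) (beta : Zc c -> R),
    [/\ (forall m, 0 <= beta m),
        (\esum_(m in [set: Zc c]) (g m * beta m)%:E < +oo)%E,
        (forall k m, exists a y w, nuclear_data (b k m) a y w (beta m)) &
        (forall x, lp_mem p x -> forall k,
            unord_sum_to (fun m => b k m (x (k - m))) (T x k))].
Proof.
move=> [_ [b [beta [b0 /(l1gE b0) boo bn Tsum]]]].
pose q : R := 2^-1 ^+ 2.
have q0 : 0 < q by rewrite exprn_gt0// invr_gt0.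
have w0 (m : Zc c) : 0 <= window q m by rewrite window_ge0// ltW.
exists b, (fun m => beta m + window q m); split => // [m||k m].
- by rewrite addr_ge0.
- under eq_esum do rewrite mulrDr EFinD.
  rewrite esumD; do ?by move=> m _; rewrite lee_fin mulr_ge0.
  apply: lte_add_pinfty => //; apply: esum_weight_window => //.
  by apply/andP; split; lra.
- have [_ bn'] := bn k m; apply: nuclear_data_exists bn' _.
  by rewrite ltrDl exprn_gt0.
Qed.

Context (T B : (Zc c -> X) -> (Zc c -> X)) (lam : R[i]).
Hypotheses (lnT : locally_nuclear p g T)
  (AB : inverse_in_B p (fun x k => lam *: x k + T x k) B).

(** The entry (k, m) of a T B is the unordered sum over j of b_(kj) composed with a times the entry
    (k - j, m - j) of [B]; hence [del] is the convolution of [beta] and [gamma]. The scalar is later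
    1 (for lam = 0) or -1/lam. *)
Lemma inverse_data : exists gamma del : Zc c -> R,
  [/\ [/\ forall m, 0 <= gamma m,
       (\esum_(m in [set: Zc c]) (g m * gamma m)%:E < +oo)%E &
       dominated p B gamma],
      forall m, 0 <= del m,
      (\esum_(m in [set: Zc c]) (g m * del m)%:E < +oo)%E &
      forall (a : R[i]) k m,
        let E v := T (fun i => a *: B (single (k - m) v) i) k in
        nuclear E /\ (nuclear_norm E <= (cabs a * del m)%:E)%E].
Proof.
have [b [beta [b0 boo bn Tsum]]] := locally_nuclear_data lnT.
have blin k m : linear_map (b k m).
  by have [a [y [w d]]] := bn k m; exact: nuclear_data_linear d.
have bbound k m v : nrm (b k m v) <= beta m * nrm v.
  by have [a [y [w d]]] := bn k m; exact: nuclear_data_bound d v.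
have [gamma [gam0 gamoo dB]] := inverse_dominated p1 wg b0 boo blin bbound Tsum AB.
pose del' := convol (fun m => (beta m)%:E) (fun m => (gamma m)%:E).
have del0 m : (0 <= del' m)%E by apply: convol_ge0 => j; rewrite lee_fin.
have deloo : (\esum_(m in [set: Zc c]) ((g m)%:E * del' m) < +oo)%E.
  apply: le_lt_trans (weighted_esum_convol g0 gM _ _) _ => [m|m|]; rewrite ?lee_fin//.
  have gb0 : (0 <= \esum_(m in [set: Zc c]) ((g m)%:E * (beta m)%:E))%E.
    by apply: esum_ge0 => m _; rewrite mule_ge0 ?lee_fin.
  by apply: lte_mul_pinfty => //; rewrite ge0_fin_numE.
have delfin m : del' m \is a fin_num.
  rewrite ge0_fin_numE//; apply: le_lt_trans deloo.
  apply: le_trans (esum_term m _); last by move=> j; rewrite mule_ge0// lee_fin.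
  by rewrite -{1}(mul1e (del' m)) lee_wpmul2r// lee_fin.
case: (AB) => _ bB _; have [Bmem Blin _] := bB.
exists gamma, (fun m => fine (del' m)); split => // [m||a k m E].
- by rewrite fine_ge0.
- by under eq_esum do rewrite EFinM fineK//.
have gamoo' : (\esum_(m in [set: Zc c]) (gamma m)%:E < +oo)%E.
  apply: le_lt_trans gamoo; apply: le_esum => j _; rewrite lee_fin.
  by rewrite -{1}(mul1r (gamma j)) ler_wpM2r.
apply: (@nuclear_unord_sum _ _ (Zc c) (b k)
  (fun j v => a *: entry B (k - j) (m - j) v) beta (fun j => cabs a * gamma (m - j))) => //.
- move=> j a' u v; rewrite (entry_linear p1 bB) scalerDr; congr (_ + _).
  by rewrite !scalerA mulrC.
- by move=> j; rewrite mulr_ge0// cabs_ge0.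
- move=> j v; rewrite nrmZ -mulrA ler_wpM2l ?cabs_ge0//.
  exact: (entry_bound p1 gam0 dB).
- rewrite EFinM fineK// /del' /convol -esumZl ?lee_fin ?cabs_ge0//; last first.
    by move=> j; rewrite mule_ge0// lee_fin.
  by apply: le_esum => j _; rewrite -!EFinM mulrCA.
- exact: ltry.
move=> v; have zp := lp_mem_single p1 (k - m) v.
have azp : lp_mem p (fun i => a *: B (single (k - m) v) i).
  have := lp_mem_lin p1 a (Bmem _ zp) (lp_mem0 p1).
  by under [X in lp_mem _ X -> _]eq_fun do rewrite addr0.
have := Tsum _ azp k; rewrite -/(E v); congr unord_sum_to.
apply/funext => j; rewrite /entry (_ : k - j - (m - j) = k - m)//.
by rewrite opprB addrA subrK.
Qed.

(** For lam = 0 the diagonal entry (0, 0) of T B = 1 is the identity of [X]. *)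
Lemma identity_nuclear : lam = 0 -> exists a y w s,
  nuclear_data (fun x : X => x) a y w s.
Proof.
move=> lam0; have [gamma [del [_ _ _ hE]]] := inverse_data.
have [_ hn] := hE 1 0 0.
have hlt : cabs 1 * del 0 < cabs 1 * del 0 + 1 by rewrite ltrDl.
have [a [y [w d]]] := nuclear_data_exists hn hlt.
exists a, y, w, (cabs 1 * del 0 + 1).
have [_ _ invAB] := AB.
move: d; congr (nuclear_data _ _ _ _ _); apply/funext => v.
have [h _] := invAB _ (lp_mem_single p1 (0 : Zc c) v).
have TBv : T (B (single 0 v)) 0 = v.
  have := congr1 (fun f => f 0) h; rewrite /= lam0 scale0r add0r => ->.
  by rewrite /single eqxx.
rewrite subr0 -[RHS]TBv; congr (T _ _).
by apply/funext => i; rewrite scale1r.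
Qed.

Lemma inverse_locally_nuclear0 : lam = 0 -> locally_nuclear p g B.
Proof.
move=> lam0; have [a [y [w [s dI]]]] := identity_nuclear lam0.
have [gamma [del [[gam0 gamoo dB] _ _ _]]] := inverse_data.
case: (AB) => _ bB _; split => //.
have s0 : 0 <= s.
  rewrite -lee_fin; have [_ _ + _] := dI; apply: le_trans.
  by apply: esum_ge0 => i _; rewrite lee_fin (nuclear_data_ge0 dI).
have sg0 m : 0 <= s * gamma m by rewrite mulr_ge0.
have gamoo' : (\esum_(m in [set: Zc c]) (gamma m)%:E < +oo)%E.
  apply: le_lt_trans gamoo; apply: le_esum => j _; rewrite lee_fin.
  by rewrite -{1}(mul1r (gamma j)) ler_wpM2r.
exists (entry B), (fun m => s * gamma m); split => //.
- apply/(l1gE sg0); under eq_esum do rewrite mulrCA EFinM.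
  rewrite esumZl ?lee_fin//; last by move=> m; rewrite lee_fin mulr_ge0.
  by apply: lte_mul_pinfty; rewrite ?lee_fin.
- move=> k m.
  (* A sum with a single term: the nuclear identity composed with the bounded entry. *)
  apply: (@nuclear_unord_sum _ _ unit (fun=> id) (fun=> entry B k m) (fun=> s)
    (fun=> gamma m)) => //.
  + by move=> _; exists a, y, w.
  + by move=> _; exact: (entry_linear p1 bB).
  + by move=> _ v; exact: (entry_bound p1 gam0 dB).
  + rewrite (_ : [set: unit] = [set tt]); last by apply/seteqP; split => -[].
    by rewrite esum_set1// lee_fin.
  + exact: ltry.
  + move=> v e e0; exists [fset tt]%fset => C; rewrite fsub1set => ttC.
    rewrite (big_fsetD1 _ ttC)/= big_seq big1 ?addr0 ?subrr ?nrm0// => -[].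
    by rewrite !inE.
- by move=> x xp k; exact: (entry_sum p1 bB gam0 gamoo' dB).
Qed.

Lemma inverse_locally_nuclear : lam != 0 ->
  locally_nuclear p g (fun x k => - lam^-1 *: x k + B x k).
Proof.
move=> lam0; have [gamma [del [[gam0 gamoo dB] del0 deloo hE]]] := inverse_data.
case: (AB) => _ bB invAB; have [Bmem Blin [M BM]] := bB.
have [[_ Tlin _] _] := lnT.
set T1 := fun x k => _.
have bT1 : bounded_op p T1.
  split=> [x xp|a x y xp yp|].
  - by apply: lp_mem_lin => //; exact: Bmem.
  - rewrite /T1 Blin//; apply/funext => k; rewrite !scalerDr !scalerA.
    by rewrite (mulrC a) addrACA.
  - exists (cabs (- lam^-1) + M) => x xp.
    have n0 k : 0 <= nrm (x k) by exact: nrm_ge0.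
    have n1 k : 0 <= nrm (B x k) by exact: nrm_ge0.
    apply: (@le_trans _ _ (lpR p (fun k => cabs (- lam^-1) * nrm (x k) + nrm (B x k)))).
      rewrite lp_normE; apply: le_lpR => // k.
      by rewrite nrm_ge0 (le_trans (nrmD _ _))// nrmZ.
    apply: le_trans (lpRD p1 _ _) _ => // [k|]; first by rewrite mulr_ge0 ?cabs_ge0.
    rewrite lpRZ ?cabs_ge0// EFinD.
    have Lfin : lp_norm p x \is a fin_num by rewrite ge0_fin_numE// lp_normE lpR_ge0.
    rewrite muleDl// -lp_normE; apply: leeD => //; exact: BM.
(* From lam B z + T B z = z, divided by lam. This exhibits the entries of [T1] as those of a T B
   with a = -1/lam. *)
have T1E z : lp_mem p z -> T1 z = T (fun i => - lam^-1 *: B z i).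
  move=> zp; have [+ _] := invAB z zp; have Bz := Bmem z zp.
  have := Tlin (- lam^-1) _ _ Bz (lp_mem0 p1).
  rewrite (bounded_op0 p1 lnT.1).
  under [X in T X = _ -> _]eq_fun do rewrite addr0.
  move=> -> ABz; apply/funext => k; rewrite /T1 addr0.
  rewrite -{1}ABz scalerDr scalerA mulNr mulVf// scaleN1r.
  by rewrite addrAC addNr add0r.
have d10 m : 0 <= cabs (- lam^-1) * del m by rewrite mulr_ge0 ?cabs_ge0.
have gamoo' : (\esum_(m in [set: Zc c]) (gamma m)%:E < +oo)%E.
  apply: le_lt_trans gamoo; apply: le_esum => j _; rewrite lee_fin.
  by rewrite -{1}(mul1r (gamma j)) ler_wpM2r.
split => //; exists (entry T1), (fun m => cabs (- lam^-1) * del m); split => //.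
- apply/(l1gE d10); under eq_esum do rewrite mulrCA EFinM.
  rewrite esumZl ?lee_fin ?cabs_ge0//; last by move=> m; rewrite lee_fin mulr_ge0.
  by apply: lte_mul_pinfty; rewrite ?lee_fin ?cabs_ge0.
- move=> k m; have := hE (- lam^-1) k m; rewrite /=.
  have -> : (fun v => T (fun i => - lam^-1 *: B (single (k - m) v) i) k) = entry T1 k m.
    by apply/funext => v; rewrite /entry T1E//; exact: lp_mem_single.
  by [].
(* The entries of [T1] are those of [B] plus those of -1/lam, which sit at offset 0 only. *)
move=> x xp k; apply: unord_sum_lin; last first.
  exact: (entry_sum p1 bB gam0 gamoo' dB).
move=> e e0; exists [fset 0]%fset => C; rewrite fsub1set => C0.
rewrite (big_fsetD1 _ C0)/= big_seq big1 => [|j].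
  by rewrite addr0 /single subr0 eqxx subrr nrm0.
rewrite !inE /single -{1}(subr0 k) (inj_eq (addrI k)) (inj_eq oppr_inj) eq_sym.
by move=> /andP[/negPf ->].
Qed.

End InverseNuclear.

(** * Fullness of the algebra *)

Lemma bounded_op_ext (R : realType) (X : completeNormedModType R[i]) (c : nat)
    (p : \bar R) (S A : (Zc c -> X) -> (Zc c -> X)) : (1 <= p)%E ->
  (forall x, lp_mem p x -> S x = A x) -> bounded_op p S -> bounded_op p A.
Proof.
move=> p1 SA [Smem Slin [M SM]]; split => [x xp|a x y xp yp|].
- by rewrite -SA//; exact: Smem.
- by rewrite -!SA ?Slin//; exact: lp_mem_lin.
- by exists M => x xp; rewrite -SA//; exact: SM.
Qed.

(** [tilde_s1g] describes [S] on l_p only, so invertibility has to be carried over to the map lam +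
    T agreeing with it there. *)
Lemma inverse_in_B_ext (R : realType) (X : completeNormedModType R[i]) (c : nat)
    (p : \bar R) (S A B : (Zc c -> X) -> (Zc c -> X)) : (1 <= p)%E ->
  (forall x, lp_mem p x -> S x = A x) -> inverse_in_B p S B -> inverse_in_B p A B.
Proof.
move=> p1 SA [bS bB SB]; split => // [|x xp]; first exact: bounded_op_ext bS.
have [Bmem _ _] := bB; have [h1 h2] := SB x xp.
by rewrite -!SA//; exact: Bmem.
Qed.

Unset Implicit Arguments.

Theorem mainTheorem1 (R : realType) (X : completeNormedModType R[i])
  (c : nat) (p : \bar R) (g : Zc c -> R) :
  (1 <= p)%E -> is_weight g ->
  (* fullness of tilde-s_{1,g} in B(l_p(Z^c, X)) *)
  (forall S B : (Zc c -> X) -> (Zc c -> X),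
      tilde_s1g p g S -> inverse_in_B p S B -> tilde_s1g p g B) /\
  (* in particular, for X infinite-dimensional *)
  (~ finite_dim X ->
   forall (T : (Zc c -> X) -> (Zc c -> X)) (lam : R[i])
          (B : (Zc c -> X) -> (Zc c -> X)),
     locally_nuclear p g T ->
     inverse_in_B p (fun x k => lam *: x k + T x k) B ->
     lam != 0 /\
     exists T1 : (Zc c -> X) -> (Zc c -> X),
       locally_nuclear p g T1 /\
       forall x, lp_mem p x -> B x = (fun k => lam^-1 *: x k + T1 x k)).
Proof.
move=> p1 wg.
have infinite_case : ~ finite_dim X ->
   forall (T : (Zc c -> X) -> (Zc c -> X)) (lam : R[i])
          (B : (Zc c -> X) -> (Zc c -> X)),
     locally_nuclear p g T ->
     inverse_in_B p (fun x k => lam *: x k + T x k) B ->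
     lam != 0 /\
     exists T1 : (Zc c -> X) -> (Zc c -> X),
       locally_nuclear p g T1 /\
       forall x, lp_mem p x -> B x = (fun k => lam^-1 *: x k + T1 x k).
  move=> Xinf T lam B lnT AB.
  have lam0 : lam != 0.
    apply/eqP => lam0; apply: Xinf.
    have [a [y [w [s dI]]]] := identity_nuclear p1 wg lnT AB lam0.
    exact: nuclear_id_finite_dim dI.
  split => //; exists (fun x k => - lam^-1 *: x k + B x k).
  split; first exact: (inverse_locally_nuclear p1 wg lnT AB).
  by move=> x _; apply/funext => k; rewrite addrA scaleNr subrr add0r.
split => // S B [Sfin Sinf] SB; split => [Xfin|Xinf].
  (* In finite dimension [S] is itself locally nuclear, which is the case lam = 0. *)
  apply: (@inverse_locally_nuclear0 _ _ _ _ _ p1 wg S B 0) => //; first exact: Sfin.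
  by apply: inverse_in_B_ext SB => // x _; apply/funext => k; rewrite scale0r add0r.
have [lam [T [lnT SE]]] := Sinf Xinf.
have [_ [T1 [lnT1 BE]]] := infinite_case Xinf T lam B lnT (inverse_in_B_ext p1 SE SB).
by exists lam^-1, T1.
Qed.
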